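(* Let $T$ be a complete theory, $M$ a small model, $\mu_x\in\mathfrak M(\mathcal U)$ a global Keisler measure that is fim over $M$, and $\lambda_y$ a global Keisler measure finitely satisfiable in $M$. Then $\mu_x\otimes\lambda_y=\lambda_y\otimes\mu_x$.
   Context: $\mathcal U$ is the monster model. Keisler measures are identified with complete regular Borel probability measures on type spaces; global means over $\mathcal U$. $\lambda$ is finitely satisfiable in $M$ if every formula of positive $\lambda$-measure is realized in $M$. For $a_1,\dots,a_n$ and a formula $\phi(x,b)$, $\mathrm{Av}(a_1,\dots,a_n;\phi(x,b))=|\{i:\models\phi(a_i,b)\}|/n$. Morley product: for global $\mu_x,\lambda_y$, an $L(\mathcal U)$-formula $\phi(x,y;b)$ and a small model $N\supseteq Mb$, let $f(q)=\mu(\phi(x,d;b))$ for $q\in S_y(N)$, $d\models q$; when $f$ is $\lambda|_N$-measurable, $\mu_x\otimes\lambda_y(\phi(x,y;b))=\int f\,d\lambda|_N$ (independent of $N$); $\lambda_y\otimes\mu_x$ is defined symmetrically by integrating $p\mapsto\lambda(\phi(c,y;b))$ ($c\models p\in S_x(N)$) against $\mu|_N$. $\mu^{(n)}$ is the Morley power $\mu_{x_n}\otimes\cdots\otimes\mu_{x_1}$. A global $M$-invariant measure $\mu$ is fim over $M$ if for every formula $\phi(x,y)$ and $\epsilon>0$ there are $n$ and an $L(M)$-formula $\theta_\epsilon(x_1,\dots,x_n)$ with $\mu^{(n)}(\theta_\epsilon)\ge1-\epsilon$ such that for all $b\in\mathcal U$ and all $(a_1,\dots,a_n)\in\theta_\epsilon(\mathcal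 U)$, $|\mu(\phi(x,b))-\mathrm{Av}(a_1,\dots,a_n;\phi(x,b))|\le\epsilon$. *)

(* Defs.v *)
From HB Require Import structures.
From mathcomp Require Import all_boot all_order all_algebra.
From mathcomp Require Import all_classical all_reals all_analysis.

Set Implicit Arguments.
Unset Strict Implicit.
Unset Printing Implicit Defensive.

Import Order.TTheory GRing.Theory Num.Theory.
Import numFieldNormedType.Exports.

Local Open Scope classical_set_scope.
Local Open Scope card_scope.
Local Open Scope ring_scope.

Record language := Language {
  fsym : Type ;
  farity : fsym -> nat ;
  rsym : Type ;
  rarity : rsym -> nat }.

Inductive term (L : language) (V : Type) : Type :=
| Var of V
| App (f : fsym L) of ('I_(farity f) -> term L V).

(* Formulas with free variables in [V]; in [FEx phi] the quantified variable
   is [None]. *)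
Inductive form (L : language) (V : Type) : Type :=
| FEq of term L V & term L V
| FRel (r : rsym L) of ('I_(rarity r) -> term L V)
| FNot of form L V
| FAnd of form L V & form L V
| FEx of form L (option V).

Fixpoint tren (L : language) (V W : Type) (h : V -> W) (t : term L V) :
    term L W :=
  match t with
  | Var v => Var L (h v)
  | App f s => App (fun i => tren h (s i))
  end.

Fixpoint fren (L : language) (V W : Type) (h : V -> W) (phi : form L V)
    {struct phi} : form L W :=
  match phi with
  | FEq s t => FEq (tren h s) (tren h t)
  | FRel r s => FRel (fun i => tren h (s i))
  | FNot p => FNot (fren h p)
  | FAnd p q => FAnd (fren h p) (fren h q)
  | FEx p => FEx (fren (omap h) p)
  end.

Fixpoint tfv (L : language) (V : Type) (t : term L V) : set V :=
  match t with
  | Var v => [set v]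
  | App f s => [set v | exists i, tfv (s i) v]
  end.

Fixpoint fv (L : language) (V : Type) (phi : form L V) {struct phi} : set V :=
  match phi with
  | FEq s t => tfv s `|` tfv t
  | FRel r s => [set v | exists i, tfv (s i) v]
  | FNot p => fv p
  | FAnd p q => fv p `|` fv q
  | FEx p => Some @^-1` fv p
  end.

Record structure (L : language) (D : Type) := Structure {
  fint : forall f : fsym L, ('I_(farity f) -> D) -> D ;
  rint : forall r : rsym L, ('I_(rarity r) -> D) -> Prop ;
  dom_inhabited : inhabited D }.

Fixpoint teval (L : language) (D : Type) (S : structure L D) (V : Type)
    (e : V -> D) (t : term L V) : D :=
  match t with
  | Var v => e v
  | App f s => fint S (fun i => teval S e (s i))
  end.

Fixpoint sat (L : language) (D : Type) (S : structure L D) (V : Type)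
    (e : V -> D) (phi : form L V) {struct phi} : Prop :=
  match phi with
  | FEq s t => teval S e s = teval S e t
  | FRel r s => rint S (fun i => teval S e (s i))
  | FNot p => ~ sat S e p
  | FAnd p q => sat S e p /\ sat S e q
  | FEx p => exists d : D,
      sat S (fun v => match v with Some w => e w | None => d end) p
  end.

Definition sentence (L : language) := form L void.

Definition models (L : language) (D : Type) (S : structure L D)
    (T : set (sentence L)) : Prop :=
  forall s, T s -> sat S (of_void D) s.

Definition entails (L : language) (T : set (sentence L)) (s : sentence L) :
    Prop :=
  forall (D : Type) (S : structure L D), models S T -> sat S (of_void D) s.

Definition complete_theory (L : language) (T : set (sentence L)) : Prop :=
  (exists (D : Type) (S : structure L D), models S T) /\
  (forall s, entails T s \/ entails T (FNot s)).

Definition elementary_embedding (L : language) (D E : Type)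
    (SD : structure L D) (SE : structure L E) (h : D -> E) : Prop :=
  forall n (phi : form L 'I_n) (a : 'I_n -> D),
    sat SD a phi <-> sat SE (h \o a) phi.

(* No closure of [A] under the functions is required: it follows from the
   embedding being elementary. *)
Definition elementary_sub (L : language) (D : Type) (S : structure L D)
    (A : set D) : Prop :=
  exists SA : structure L A, elementary_embedding SA S (\val : A -> D).

Definition automorphism (L : language) (D : Type) (S : structure L D)
    (g : D -> D) : Prop :=
  [/\ bijective g,
      forall f (s : 'I_(farity f) -> D), g (fint S s) = fint S (g \o s) &
      forall r (s : 'I_(rarity r) -> D), rint S s <-> rint S (g \o s)].

(* An [L(U)]-formula in the tuple of variables [x = (x_i)_(i : I)] is an
   element of [form L (I + U)]: the free variable [inl i] is [x_i], and the free
   variable [inr u] is the parameter [u]. *)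
Definition pform (L : language) (U I : Type) := form L (I + U)%type.

Definition over (L : language) (U I : Type) (A : set U) (phi : pform L U I) :
    Prop :=
  forall u, fv phi (inr u) -> A u.

Definition holds (L : language) (U : Type) (S : structure L U) (I : Type)
    (phi : pform L U I) (a : I -> U) : Prop :=
  sat S (fun v : I + U => match v with inl i => a i | inr u => u end) phi.

(* [phi(x, b)] for an [L]-formula [phi(x, y)]. *)
Definition inst (L : language) (U I J : Type) (phi : form L (I + J)%type)
    (b : J -> U) : pform L U I :=
  fren (fun v : I + J => match v with inl i => inl i | inr j => inr (b j) end)
    phi.

(* [phi(x, d)] for an [L(U)]-formula [phi(x, y)]. *)
Definition pinst (L : language) (U I J : Type) (phi : pform L U (I + J)%type)
    (d : J -> U) : pform L U I :=
  fren (fun v : (I + J) + U => match v with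
        | inl (inl i) => inl i
        | inl (inr j) => inr (d j)
        | inr u => inr u
        end) phi.

Definition pren (L : language) (U I J : Type) (h : I -> J)
    (phi : pform L U I) : pform L U J :=
  fren (fun v : I + U => match v with inl i => inl (h i) | inr u => inr u end)
    phi.

(* The space [S_x(A)], [x = (x_i)_(i : I)]: maximal sets of [L(A)]-formulas that
   are finitely satisfiable in [S]. *)
Record ctype (L : language) (U : Type) (S : structure L U) (A : set U)
    (I : Type) := CType {
  tset :> pform L U I -> Prop ;
  ctype_over : forall phi, tset phi -> over A phi ;
  ctype_fsat : forall X : set (pform L U I), finite_set X -> X `<=` tset ->
    exists a : I -> U, forall phi, X phi -> holds S phi a ;
  ctype_complete : forall phi, over A phi -> tset phi \/ tset (FNot phi) }.

Definition realizes (L : language) (U : Type) (S : structure L U) (A : set U)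
    (I : Type) (p : ctype S A I) (a : I -> U) : Prop :=
  forall phi, p phi -> holds S phi a.

Section TypeSpace.
Context (L : language) (U : Type) (S : structure L U).

Lemma tp_fsat (A : set U) (I : Type) (a : I -> U) (X : set (pform L U I)) :
  finite_set X -> X `<=` [set phi | over A phi /\ holds S phi a] ->
  exists c : I -> U, forall phi, X phi -> holds S phi c.
Proof. by move=> _ XA; exists a => phi /XA[]. Qed.

Lemma tp_complete (A : set U) (I : Type) (a : I -> U) (phi : pform L U I) :
  over A phi -> (over A phi /\ holds S phi a) \/
                (over A (FNot phi : pform L U I) /\ holds S (FNot phi) a).
Proof.
move=> Aphi.
by have [h|h] := pselect (holds S phi a); [left|right].
Qed.

Definition tp (A : set U) (I : Type) (a : I -> U) : ctype S A I :=
  CType (fun phi => @proj1 _ _) (@tp_fsat A I a) (@tp_complete A I a).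

Lemma tres_fsat (A B : set U) (I : Type) (p : ctype S B I)
    (X : set (pform L U I)) :
  finite_set X -> X `<=` [set phi | over A phi /\ p phi] ->
  exists c : I -> U, forall phi, X phi -> holds S phi c.
Proof. by move=> finX XA; apply: (ctype_fsat finX) => phi /XA[_]; apply. Qed.

Lemma tres_complete (A B : set U) (AB : A `<=` B) (I : Type) (p : ctype S B I)
    (phi : pform L U I) :
  over A phi -> (over A phi /\ p phi) \/
                (over A (FNot phi : pform L U I) /\ p (FNot phi)).
Proof.
move=> Aphi; have [] := @ctype_complete _ _ _ _ _ p phi.
- by move=> u /Aphi /AB.
- by left.
- by right.
Qed.

Definition tres (A B : set U) (AB : A `<=` B) (I : Type) (p : ctype S B I) :
    ctype S A I :=
  CType (fun phi => @proj1 _ _) (@tres_fsat A B I p)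
    (@tres_complete A B AB I p).

Variables (A : set U) (I : Type).

HB.instance Definition _ := gen_eqMixin (ctype S A I).
HB.instance Definition _ := gen_choiceMixin (ctype S A I).

Lemma ctype_inhabited : $| ctype S A I |.
Proof. by have [u] := dom_inhabited S; apply: squash; exact: tp (fun=> u). Qed.

HB.instance Definition _ := isPointed.Build (ctype S A I)
  (unsquash ctype_inhabited).

Definition clop (phi : pform L U I) : set (ctype S A I) :=
  [set p : ctype S A I | p phi].

Definition ctype_open (O : set (ctype S A I)) : Prop :=
  forall p, O p -> exists2 phi, p phi & clop phi `<=` O.

Lemma ctype_holdsT (phi : pform L U I) (p : ctype S A I) :
  over A phi -> (forall a, holds S phi a) -> p phi.
Proof.
move=> Aphi ht; have [//|np] := ctype_complete p Aphi.
have [a /(_ _ erefl) /=] := ctype_fsat (finite_set1 (FNot phi))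
  (fun psi (e : psi = FNot phi) => eq_ind_r (tset p) np e).
by move=> /(_ (ht a)).
Qed.

Lemma ctype_and (p : ctype S A I) (phi psi : pform L U I) :
  p phi -> p psi -> p (FAnd phi psi).
Proof.
move=> pphi ppsi.
have [|//|np] := @ctype_complete _ _ _ _ _ p (FAnd phi psi).
  by move=> u [/(ctype_over pphi)|/(ctype_over ppsi)].
have [] := @ctype_fsat _ _ _ _ _ p [set phi; psi; FNot (FAnd phi psi)].
- by rewrite !finite_setU; do !split; exact: finite_set1.
- by move=> chi [[->|->]|->].
- move=> a H; have /= := H _ (or_intror erefl); case; split.
  + by apply: H; left; left.
  + by apply: H; left; right.
Qed.

Lemma ctype_andE (p : ctype S A I) (phi psi : pform L U I) :
  over A phi -> over A psi -> p (FAnd phi psi) -> p phi /\ p psi.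
Proof.
move=> Aphi Apsi pand.
have aux (chi : pform L U I) : over A chi ->
    (forall a, holds S (FAnd phi psi) a -> holds S chi a) -> p chi.
  move=> Achi H; have [//|np] := ctype_complete p Achi.
  have [] := @ctype_fsat _ _ _ _ _ p [set FAnd phi psi; FNot chi].
  - exact: finite_set2.
  - by move=> ? [->|->].
  - by move=> a Ha; have := Ha _ (or_intror erefl);
      case; apply: H; apply: Ha; left.
by split; apply: aux => // a [].
Qed.

Lemma ctype_openT : ctype_open setT.
Proof.
move=> p _.
pose phi : pform L U I := FEx (FEq (Var L None) (Var L None)).
exists phi => //; apply: ctype_holdsT => [u [] //|a].
by have [u] := dom_inhabited S; exists u.
Qed.

Lemma ctype_openI : setI_closed ctype_open.
Proof.
move=> O O' oO oO' p [/oO [phi pphi sO] /oO' [psi ppsi sO']].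
exists (FAnd phi psi); first exact: ctype_and.
move=> q qand.
have [] := ctype_andE (ctype_over pphi) (ctype_over ppsi) qand.
by move=> /sO ? /sO'.
Qed.

Lemma ctype_open_bigU (K : Type) (F : K -> set (ctype S A I)) :
  (forall k, ctype_open (F k)) -> ctype_open (\bigcup_k F k).
Proof.
move=> oF p [k _ /oF [phi pphi sF]]; exists phi => // q /sF Fq.
by exists k.
Qed.

HB.instance Definition _ := isOpenTopological.Build (ctype S A I)
  ctype_openT ctype_openI ctype_open_bigU.

Definition borel_ctype := g_sigma_algebraType (@open (ctype S A I)).

End TypeSpace.

(* [K] is any type of cardinality kappa; [small K A] means [|A| < kappa]. *)
Definition small (K U : Type) (A : set U) : Prop := ~ ([set: K] #<= A).

Definition saturated (K : Type) (L : language) (U : Type)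
    (S : structure L U) : Prop :=
  forall (A : set U) n (p : ctype S A 'I_n), small K A ->
    exists a, realizes p a.

Definition strongly_homogeneous (K : Type) (L : language) (U : Type)
    (S : structure L U) : Prop :=
  forall (A : set U) (f : A -> U), small K A ->
    (forall n (phi : form L 'I_n) (a : 'I_n -> A),
       sat S (fun i => \val (a i)) phi <-> sat S (f \o a) phi) ->
    exists2 g, automorphism S g & forall a : A, g (\val a) = f a.

(* kappa-saturated and strongly kappa-homogeneous, where kappa is larger than
   the number of [L]-formulas. *)
Definition monster (K : Type) (L : language) (U : Type) (S : structure L U) :
    Prop :=
  [/\ small K [set: form L nat], saturated K S & strongly_homogeneous K S].

(* A global Keisler measure, as a regular Borel probability measure on
   [S_x(U)]; completions are dealt with in [integral_is]. *)
Record keisler (R : realType) (L : language) (U : Type) (S : structure L U)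
    (I : Type) := Keisler {
  kmeas : probability (borel_ctype S [set: U] I) R ;
  kmeas_regular : forall B : set (borel_ctype S [set: U] I), measurable B ->
    forall e : R, 0 < e ->
    exists C O : set (ctype S [set: U] I),
      [/\ compact C, open O, C `<=` B, B `<=` O &
          (kmeas (O `\` C) < e%:E)%E] }.

Section Keisler.
Context (R : realType) (L : language) (U : Type) (S : structure L U).

Definition kval (I : Type) (mu : keisler R S I) (phi : pform L U I) : R :=
  fine (kmeas mu [set p : ctype S [set: U] I | p phi]).

(* [mu|_N], as a measure on [S_x(N)]. *)
Definition krestr (I : Type) (mu : keisler R S I) (N : set U) :
    set (borel_ctype S N I) -> \bar R :=
  pushforward (kmeas mu)
    (tres (@subsetT U N) (I := I) :
       borel_ctype S [set: U] I -> borel_ctype S N I).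

(* [b] and [b'] have the same type over [M]. *)
Definition same_type (M : set U) (J : Type) (b b' : J -> U) : Prop :=
  forall phi : pform L U J, over M phi -> holds S phi b <-> holds S phi b'.

Definition invariant (M : set U) (I : Type) (mu : keisler R S I) : Prop :=
  forall k (phi : form L (I + 'I_k)%type) (b b' : 'I_k -> U),
    same_type M b b' -> kval mu (inst phi b) = kval mu (inst phi b').

Definition finitely_satisfiable (M : set U) (I : Type) (mu : keisler R S I) :
    Prop :=
  forall phi : pform L U I, 0 < kval mu phi ->
    exists a : I -> U, (forall i, M (a i)) /\ holds S phi a.

(* [f] is measurable for the completion of the Borel measure [P], and its
   integral is [r]. *)
Definition integral_is (N : set U) (J : Type)
    (P : set (borel_ctype S N J) -> \bar R) (f : borel_ctype S N J -> R)
    (r : R) : Prop :=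
  exists g : borel_ctype S N J -> R,
    [/\ measurable_fun [set: borel_ctype S N J] g,
        (\forall q \ae P, f q = g q) &
        (\int[P]_(q in [set: borel_ctype S N J]) (g q)%:E)%E = r%:E].

(* The value [r] of [mu_x (x) la_y] at the [L(U)]-formula [phi(x, y)],
   computed over [N]. *)
Definition morley_value_at (I J : Type) (mu : keisler R S I)
    (la : keisler R S J) (phi : pform L U (I + J)%type) (N : set U) (r : R) :
    Prop :=
  exists f : borel_ctype S N J -> R,
    (forall (q : ctype S N J) (d : J -> U), realizes q d ->
       f q = kval mu (pinst phi d)) /\
    integral_is (krestr la (N := N)) f r.

(* [N] is a small model containing [M] and the parameters of [phi]. *)
Definition model_around (K : Type) (M : set U) (I : Type) (phi : pform L U I)
    (N : set U) : Prop :=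
  [/\ small K N, elementary_sub S N, M `<=` N & over N phi].

(* [mu_x (x) la_y] is defined at [phi(x, y)] and its value is [r]; the value
   has to be the same for all admissible [N] (the existence of an admissible
   [N] is included so that the second clause is never vacuous). *)
Definition morley_value (K : Type) (M : set U) (I J : Type)
    (mu : keisler R S I) (la : keisler R S J) (phi : pform L U (I + J)%type)
    (r : R) : Prop :=
  (exists N, model_around K M phi N) /\
  (forall N, model_around K M phi N -> morley_value_at mu la phi N r).

Definition morley_product (K : Type) (M : set U) (I J : Type)
    (mu : keisler R S I) (la : keisler R S J)
    (nu : pform L U (I + J)%type -> R) : Prop :=
  forall phi, morley_value K M mu la phi (nu phi).

(* The variables [(x_(n+2) ; x_1, ..., x_(n+1))] as [(x_1, ..., x_(n+2))];
   [x_k] has index [k - 1]. *)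
Definition last_var (I : Type) (n : nat) (v : (I + 'I_n.+1 * I)%type) :
    ('I_n.+2 * I)%type :=
  match v with
  | inl i => (ord_max, i)
  | inr (k, i) => (widen_ord (leqnSn n.+1) k, i)
  end.

(* [nu] is the Morley power mu^(n+1), in the variables [x_1, ..., x_(n+1)]:
   mu^(1) = mu_(x_1) and mu^(n+2) = mu_(x_(n+2)) (x) mu^(n+1). *)
Fixpoint morley_power (K : Type) (M : set U) (I : Type) (mu : keisler R S I)
    (n : nat) : keisler R S ('I_n.+1 * I)%type -> Prop :=
  match n return keisler R S ('I_n.+1 * I)%type -> Prop with
  | 0 => fun nu => forall phi, kval nu phi = kval mu (pren snd phi)
  | m.+1 => fun nu => exists2 nu' : keisler R S ('I_m.+1 * I)%type,
      morley_power K M mu nu' &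
      morley_product K M mu nu'
        (fun phi => kval nu (pren (@last_var I m) phi))
  end.

Definition Av (n : nat) (I : Type) (a : 'I_n -> I -> U) (phi : pform L U I) :
    R :=
  #|[pred i | `[< holds S phi (a i) >]]|%:R / n%:R.

Definition fim (K : Type) (M : set U) (I : Type) (mu : keisler R S I) : Prop :=
  invariant M mu /\
  forall k (phi : form L (I + 'I_k)%type) (e : R), 0 < e ->
  exists n (theta : pform L U ('I_n.+1 * I)%type)
         (nu : keisler R S ('I_n.+1 * I)%type),
    [/\ over M theta, morley_power K M mu nu, 1 - e <= kval nu theta &
        forall (b : 'I_k -> U) (a : 'I_n.+1 -> I -> U),
          holds S theta (fun v => a v.1 v.2) ->
          `| kval mu (inst phi b) - Av a (inst phi b) | <= e].

End Keisler.

(* [phi(y, x)] as a formula in the tuple [(x, y)]. *)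
Definition pswap (L : language) (U I J : Type) (phi : pform L U (J + I)%type) :
    pform L U (I + J)%type :=
  pren (fun v : J + I => match v with inl j => inr j | inr i => inl i end) phi.

(* Main.v *)
(**
  The function [q |-> mu(phi(x, d))], [d |= q], is by fim a uniform limit of
  averages of the clopen functions [phi(a_i, y)], with [a] in [theta_e]; so it
  is continuous, and the value [r] of [mu (x) la] at [phi] satisfies
  [|r - (1/n) sum_i la(phi(a_i, y))| <= e] for every [a] in [theta_e].  Put
  [f(tp(c)) = la(phi(c, y))].  The function [f] need not be Borel, but by the
  above its averages over any tuple in [theta_e], a set of [mu^(n)]-measure at
  least [1 - e], are within [e] of [r].  Let [g >= f] be a Borel envelope of
  [f].  The set where [f] is close to [g] has full outer measure, and by
  induction on [n] (a Fubini argument) so has its n-th power for [mu^(n)]; hence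
  the averages of [g] are essentially bounded by [r + e] on [theta_e], and the
  integral of [g] is at most [r].  The same bound for [1 - f] shows that the
  lower and the upper integral of [f] are both [r]: thus [f] is measurable for
  the completion of [mu] and its integral is [r].
*)

(* Two obstacles shape the Fubini step. The set where [f] is close to its envelope need not be
   Borel, and the type of a tuple is not determined by the types of its coordinates, so mu^(n) is
   not a product measure on a product space. The induction therefore builds realized tuples: a
   formula of large measure in n+1 variables yields one of large measure in the first n; a suitable
   realization of it leaves a fibre of large mu-measure, in which saturation supplies the last
   coordinate. The bound on the integral of [g] rests on marginals: each coordinate has law mu, so
   the average of a step function over a tuple has the right mean. As the average is at most 1,
   Markov's inequality keeps it above that mean, up to a small error, on a set of measure 2e, and
   the complement of theta_e cannot absorb this set. Because fim tuples compute Morley products as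
   finite averages, most estimates become linear inequalities between measures of finitely many
   formulas, and these are checked on truth values at points of the model. *)
From HB Require Import structures.
Require Import Defs.
From mathcomp Require Import all_boot all_order all_algebra.
From mathcomp Require Import all_classical all_reals all_analysis.
From mathcomp Require Import measurable_realfun zify ring lra.

Set Implicit Arguments.
Unset Strict Implicit.
Unset Printing Implicit Defensive.

Import Order.TTheory GRing.Theory Num.Theory.
Import numFieldNormedType.Exports.
(* MathComp also has a [form]. *)
Import Defs.

Local Open Scope classical_set_scope.
Local Open Scope card_scope.

(** * Syntax *)

Section Syntax.
Context (L : language).

Lemma tren_comp (V W X : Type) (h : V -> W) (k : W -> X) (t : term L V) :
  tren k (tren h t) = tren (k \o h) t.
Proof. by elim: t => [//|f s IH] /=; congr App; apply: funext. Qed.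

Lemma eq_tren (V W : Type) (h k : V -> W) (t : term L V) :
  (forall v, tfv t v -> h v = k v) -> tren h t = tren k t.
Proof.
elim: t => [v|f s IH] /= e; first by rewrite e.
by congr App; apply: funext => i; apply: IH => v tv; apply: e; exists i.
Qed.

Lemma fren_comp (V W X : Type) (h : V -> W) (k : W -> X) (phi : form L V) :
  fren k (fren h phi) = fren (k \o h) phi.
Proof.
elim: phi W X h k => /= [{}V s t|{}V r s|{}V p IH|{}V p IHp q IHq|{}V p IH]
  W X h k.
- by rewrite !tren_comp.
- by congr FRel; apply: funext => i; rewrite tren_comp.
- by rewrite IH.
- by rewrite IHp IHq.
- by rewrite IH; congr (FEx (fren _ _)); apply: funext => -[].
Qed.

Lemma eq_fren (V W : Type) (h k : V -> W) (phi : form L V) :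
  (forall v, fv phi v -> h v = k v) -> fren h phi = fren k phi.
Proof.
elim: phi W h k => /= [{}V s t|{}V r s|{}V p IH|{}V p IHp q IHq|{}V p IH]
  W h k e.
- by congr FEq; apply: eq_tren => v ?; apply: e; [left|right].
- congr FRel; apply: funext => i; apply: eq_tren => v ?; apply: e.
  by exists i.
- by rewrite (IH _ h k).
- by congr FAnd; [apply: IHp|apply: IHq] => v ?; apply: e; [left|right].
- by congr FEx; apply: IH => -[v|//] pv /=; congr Some; exact: e.
Qed.

Lemma tren_id (V : Type) (t : term L V) : tren id t = t.
Proof. by elim: t => [//|f s IH] /=; congr App; apply: funext. Qed.

Lemma fren_id (V : Type) (phi : form L V) : fren id phi = phi.
Proof.
elim: phi => /= [{}V s t|{}V r s|{}V p IH|{}V p IHp q IHq|{}V p IH].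
- by rewrite !tren_id.
- by congr FRel; apply: funext => i; rewrite tren_id.
- by rewrite IH.
- by rewrite IHp IHq.
- by rewrite -[in RHS]IH; congr FEx; apply: eq_fren => -[].
Qed.

Lemma tfv_tren (V W : Type) (h : V -> W) (t : term L V) :
  tfv (tren h t) = h @` tfv t.
Proof.
elim: t => [v|f s IH] /=; first by rewrite image_set1.
apply/seteqP; split=> [w [i]|_ [v [i sv] <-]].
  by rewrite IH => -[v sv <-]; exists v => //; exists i.
by exists i; rewrite IH; exists v.
Qed.

Lemma fv_fren (V W : Type) (h : V -> W) (phi : form L V) :
  fv (fren h phi) = h @` fv phi.
Proof.
elim: phi W h => /= [{}V s t|{}V r s|{}V p IH|{}V p IHp q IHq|{}V p IH] W h.
- by rewrite !tfv_tren image_setU.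
- apply/seteqP; split=> [w [i]|_ [v [i sv] <-]].
    by rewrite tfv_tren => -[v sv <-]; exists v => //; exists i.
  by exists i; rewrite tfv_tren; exists v.
- by rewrite IH.
- by rewrite IHp IHq image_setU.
- rewrite IH; apply/seteqP; split=> [w [[v|//] pv [<-]]|_ [v pv <-]].
    by exists v.
  by exists (Some v).
Qed.

Lemma finite_tfv (V : Type) (t : term L V) : finite_set (tfv t).
Proof.
elim: t => [v|f s IH] /=; first exact: finite_set1.
rewrite (_ : mkset _ = \bigcup_(i in [set: 'I_(farity f)]) tfv (s i)).
  by apply: bigcup_finite => //; exact: finite_finset.
by apply/seteqP; split=> v /= [i]; [exists i|move=> _ ?; exists i].
Qed.

Lemma finite_fv (V : Type) (phi : form L V) : finite_set (fv phi).
Proof.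
elim: phi => /= [{}V s t|{}V r s|{}V p IH|{}V p IHp q IHq|{}V p IH] //.
- by rewrite finite_setU; split; exact: finite_tfv.
- rewrite (_ : mkset _ = \bigcup_(i in [set: 'I_(rarity r)]) tfv (s i)).
    by apply: bigcup_finite => [|i _]; [exact: finite_finset|exact: finite_tfv].
  by apply/seteqP; split=> v /= [i]; [exists i|move=> _ ?; exists i].
- by rewrite finite_setU.
- have /eq_finite_set <- : Some @` (Some @^-1` fv p) #= Some @^-1` fv p.
    by apply: inj_card_eq => v w _ _ [].
  by apply: sub_finite_set IH => _ [v pv <-].
Qed.

Context (D : Type) (S : structure L D).

Lemma teval_tren (V W : Type) (h : V -> W) (e : W -> D) (t : term L V) :
  teval S e (tren h t) = teval S (e \o h) t.
Proof. by elim: t => [//|f s IH] /=; congr fint; apply: funext. Qed.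

Lemma sat_fren (V W : Type) (h : V -> W) (e : W -> D) (phi : form L V) :
  sat S e (fren h phi) <-> sat S (e \o h) phi.
Proof.
elim: phi W h e => /= [{}V s t|{}V r s|{}V p IH|{}V p IHp q IHq|{}V p IH] W h e.
- by rewrite !teval_tren.
- by under eq_fun do rewrite teval_tren.
- by rewrite IH.
- by rewrite IHp IHq.
- split=> -[d]; rewrite ?IH => pd; exists d; move: pd; rewrite ?IH;
    by congr (sat S _ p); apply: funext => -[].
Qed.

End Syntax.

(** * Finitely many parameters, and blocks of existential quantifiers *)

Section FinitelyManyParameters.
Context (L : language).

Lemma finite_params (X U : Type) (phi : form L (X + U)%type) :
  finite_set [set u | fv phi (inr u)].
Proof.
have /eq_finite_set <- : @inr X U @` [set u | fv phi (inr u)] #=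
    [set u | fv phi (inr u)].
  by apply: inj_card_eq => v w _ _ [].
by apply: sub_finite_set (finite_fv phi) => _ [v pv <-].
Qed.

Lemma param_fin (I U : Type) (u0 : U) (phi : pform L U I) :
  exists k (phi' : form L (I + 'I_k)%type) (c : 'I_k -> U),
    phi = inst phi' c /\ forall i, fv phi (inr (c i)) \/ c i = u0.
Proof.
have [s sE] := @finite_seqP {classic U} [set u | fv phi (inr u)].
have {s sE} [s sE] := s (finite_params phi).
have memP u : fv phi (inr u) <-> (u : {classic U}) \in s.
  by rewrite -[is_true _]/([set` s] u) -sE.
(* One index beyond the list of parameters keeps the index type inhabited for [inord]; [nth] fills
   it with [u0], whence the second alternative in the conclusion. *)
pose idx (u : U) : 'I_(size s).+1 := inord (index (u : {classic U}) s).
pose c (i : 'I_(size s).+1) : U := nth (u0 : {classic U}) s i.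
pose h (v : I + U) : (I + 'I_(size s).+1)%type :=
  match v with inl i => inl i | inr u => inr (idx u) end.
exists (size s).+1, (fren h phi), c; split.
  rewrite /inst fren_comp -[LHS]fren_id; apply: eq_fren => -[//|u] /memP us.
  by rewrite /= /c /idx inordK ?nth_index// ltnS index_size.
move=> i; rewrite /c; have [lt_i|ge_i] := ltnP i (size s).
  by left; apply/memP; rewrite mem_nth.
by right; rewrite nth_default.
Qed.

(** [psi] is chosen before the structure, because [elementary_realize] reads the same formula in the
    submodel and in the large model. *)
Lemma ex_tuple (n : nat) (W : Type) (phi : form L ('I_n + W)%type) :
  exists psi : form L W, forall (D : Type) (S : structure L D) (e : W -> D),
    sat S e psi <->
    exists a : 'I_n -> D,
      sat S (fun v => match v with inl i => a i | inr w => e w end) phi.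
Proof.
elim: n phi => [|n IH] phi.
  pose h (v : 'I_0 + W) : W := match v with
    | inl i => False_rect _ (notF (ltn_ord i)) | inr w => w end.
  exists (fren h phi) => D S e; rewrite sat_fren; split.
    have f (i : 'I_0) : D by case: i.
    move=> H; exists f; move: H; congr sat; apply: funext => -[i|//].
    by case: i.
  by case=> f; congr sat; apply: funext => -[i|//]; case: i.
pose h (v : 'I_n.+1 + W) : option ('I_n + W) :=
  match v with
  | inl i => omap inl (unlift ord0 i)
  | inr w => Some (inr w)
  end.
have [psi psiE] := IH (FEx (fren h phi)).
exists psi => D S e; rewrite psiE; split=> [[a /= [d]]|[a H]].
  rewrite sat_fren => H.
  exists (fun i => if unlift ord0 i is Some j then a j else d).
  move: H; congr sat; apply: funext => -[i|//] /=.
  by case: unlift.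
exists (fun j => a (lift ord0 j)); exists (a ord0); rewrite sat_fren.
move: H; congr sat; apply: funext => -[i|//] /=.
by case: unliftP => [j|] ->.
Qed.

End FinitelyManyParameters.

Section Formulas.
Context (L : language) (U : Type) (S : structure L U).

Lemma holds_inst (I J : Type) (phi : form L (I + J)%type) (b : J -> U)
    (a : I -> U) :
  holds S (inst phi b) a <->
  sat S (fun v => match v with inl i => a i | inr j => b j end) phi.
Proof.
rewrite /holds sat_fren; suff -> : (fun v : I + U => match v with
  | inl i => a i | inr u => u end) \o (fun v : I + J => match v with
  | inl i => inl i | inr j => inr (b j) end) =
  (fun v => match v with inl i => a i | inr j => b j end) by [].
by apply: funext => -[].
Qed.

Lemma holds_pren (I J : Type) (h : I -> J) (phi : pform L U I) (a : J -> U) :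
  holds S (pren h phi) a <-> holds S phi (a \o h).
Proof.
rewrite /holds sat_fren.
rewrite (_ : _ \o _ = fun v => match v with inl i => (a \o h) i | inr u => u end) //.
by apply: funext => -[].
Qed.

Definition glue (I J : Type) (a : I -> U) (b : J -> U) (v : I + J) : U :=
  match v with inl i => a i | inr j => b j end.

Lemma holds_pinst (I J : Type) (phi : pform L U (I + J)%type) (d : J -> U)
    (a : I -> U) :
  holds S (pinst phi d) a <-> holds S phi (glue a d).
Proof.
rewrite /holds sat_fren.
rewrite (_ : _ \o _ = fun v => match v with inl i => (glue a d) i | inr u => u end) //.
by apply: funext => -[[]|].
Qed.

Lemma holds_pswap (I J : Type) (phi : pform L U (J + I)%type) (a : I -> U)
    (d : J -> U) :
  holds S (pswap phi) (glue a d) <-> holds S phi (glue d a).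
Proof.
rewrite holds_pren (_ : _ \o _ = glue d a)//.
by apply: funext => -[].
Qed.

Lemma pren_comp (I J J' : Type) (h : I -> J) (k : J -> J') (phi : pform L U I) :
  pren k (pren h phi) = pren (k \o h) phi.
Proof. by rewrite /pren fren_comp; congr fren; apply: funext => -[]. Qed.

Lemma pren_id (I : Type) (phi : pform L U I) : pren id phi = phi.
Proof.
by rewrite /pren -[RHS]fren_id; congr fren; apply: funext => -[].
Qed.

Lemma pswapK (I J : Type) (phi : pform L U (J + I)%type) :
  pswap (pswap phi) = phi.
Proof.
rewrite /pswap pren_comp -[RHS]pren_id; congr pren.
by apply: funext => -[].
Qed.

Lemma over_pren (A : set U) (I J : Type) (h : I -> J) (phi : pform L U I) :
  over A phi -> over A (pren h phi).
Proof.
move=> Aphi u; rewrite /pren fv_fren => -[[i|v] fvv] // -[<-].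
exact: Aphi.
Qed.

Lemma over_pswap (A : set U) (I J : Type) (phi : pform L U (J + I)%type) :
  over A phi -> over A (pswap phi).
Proof. exact: over_pren. Qed.

Lemma over_pinst (A : set U) (I J : Type) (phi : pform L U (I + J)%type)
    (d : J -> U) :
  over A phi -> over (A `|` range d) (pinst phi d).
Proof.
move=> Aphi u; rewrite /pinst fv_fren => -[[[i|j]|v] fvv] // [<-].
  by right; exists j.
by left; exact: Aphi.
Qed.

Lemma overS (A B : set U) (I : Type) (phi : pform L U I) :
  A `<=` B -> over A phi -> over B phi.
Proof. by move=> AB Aphi u /Aphi /AB. Qed.

Lemma same_type_sym (A : set U) (I : Type) (b b' : I -> U) :
  same_type S A b b' -> same_type S A b' b.
Proof. by move=> h phi Aphi; rewrite h. Qed.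

Lemma elementary_realize (N : set U) (V : finType) (phi : pform L U V) :
  elementary_sub S N -> over N phi -> (exists a, holds S phi a) ->
  exists a : V -> U, (forall v, N (a v)) /\ holds S phi a.
Proof.
move=> [SN NS] Nphi [a pa].
have [u0] := dom_inhabited SN.
have [k [phi' [c [phiE cP]]]] := param_fin (\val u0) phi.
have Nc i : N (c i).
  by have [/Nphi//|->] := cP i; exact: set_valP.
pose cN i : N := SigSub (mem_set (Nc i)).
pose phi1 : form L ('I_#|V| + 'I_k)%type :=
  fren (fun v => match v with inl v => inl (enum_rank v) | inr i => inr i end)
    phi'.
have [psi psiE] := ex_tuple phi1.
have : sat S (\val \o cN) psi.
  apply/psiE; exists (a \o enum_val); rewrite /phi1 sat_fren.
  move: pa; rewrite phiE holds_inst; congr sat; apply: funext => -[v|i] //=.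
  by rewrite enum_rankK.
rewrite -NS psiE => -[b bP].
(* An elementary embedding is tested only on formulas with variables in some ['I_n], so witnesses
   and parameters are merged into one such tuple. *)
have {}bP : sat SN (fun i : 'I_(#|V| + k) =>
    match fintype.split i with inl i => b i | inr i => cN i end)
    (fren (@unsplit #|V| k) phi1).
  rewrite sat_fren; move: bP; congr sat; apply: funext => v /=.
  by rewrite unsplitK.
exists (fun v => \val (b (enum_rank v))); split=> [v|]; first exact: set_valP.
move: bP; rewrite NS sat_fren /phi1 sat_fren phiE holds_inst.
congr sat; apply: funext => -[v|i] /=.
  by rewrite (unsplitK (inl _)).
by rewrite (unsplitK (inr _)).
Qed.

End Formulas.

(** * Cardinals and elementary submodels *)

Section Cardinals.

Definition embeds (A B : Type) : Prop := exists f : A -> B, injective f.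

Lemma val_sigI (A : Type) (P : A -> Prop) (x y : {a | P a}) :
  sval x = sval y -> x = y.
Proof. by case: x y => [a p] [b q] /= E; exact: eq_exist. Qed.

Lemma embeds_trans (A B C : Type) : embeds A B -> embeds B C -> embeds A C.
Proof. by move=> [f fi] [g gi]; exists (g \o f); exact: inj_comp. Qed.

Lemma embeds_onto (A B : Type) (a : A) : embeds A B ->
  exists r : B -> A, forall x, exists y, r y = x.
Proof.
move=> [f fi]; exists (fun y => if pselect (exists x, f x = y) is left h
  then projT1 (cid h) else a) => x; exists (f x).
by case: pselect => [h|[]]; [apply: fi; exact: projT2 (cid h)|exists x].
Qed.

(** By Zorn there is a maximal partial injection. If it missed points on both sides, a pair of
    missed points could be added. *)
Lemma embeds_total (A B : Type) : embeds A B \/ embeds B A.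
Proof.
pose P (G : set (A * B)) := forall p q, G p -> G q -> p.1 = q.1 <-> p.2 = q.2.
have [|G [PG maxG]] := @Zorn_bigcup _ P.
  move=> F FP totF p q [X FX Xp] [Y FY Yq].
  by have [XY|YX] := totF _ _ FX FY; [apply: (FP Y)|apply: (FP X)]; auto.
have [totA|] := pselect (forall a, exists b, G (a, b)).
  have [f fG] := choice totA; left; exists f => a a' e.
  exact/(PG _ _ (fG a) (fG a')).
move=> /existsNP[a /forallNP na].
have [totB|] := pselect (forall b, exists a, G (a, b)).
  have [f fG] := choice totB; right; exists f => b b' e.
  exact/(PG _ _ (fG b) (fG b')).
move=> /existsNP[b /forallNP nb].
have [] := maxG (G `|` [set (a, b)]); first split; first by move=> ? ?; left.
  by move=> /(_ (a, b) (or_intror erefl)) /na.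
move=> [x y] [x' y'] [p|[-> ->]] [q|[-> ->]] //=; first exact: (PG _ _ p q).
- by split=> e; subst; exfalso; [apply: na p|apply: nb p].
- by split=> e; subst; exfalso; [apply: na q|apply: nb q].
Qed.

(** * The square of an infinite type embeds in the type *)

Section Square.
Variable T : Type.

Let fld (G : set (T * T * T)) : set T := [set x | exists z, G (x, x, z)].

(** The graphs of injections from the square of [fld G] into [fld G], the field being read off the
    diagonal. As bare relations, such graphs form a family closed under unions of chains. *)
Let sq (G : set (T * T * T)) :=
  [/\ forall p q, G p -> G q -> p.1 = q.1 <-> p.2 = q.2,
      forall x y z, G (x, y, z) -> [/\ fld G x, fld G y & fld G z] &
      forall x y, fld G x -> fld G y -> exists z, G (x, y, z)].

Lemma fldS (G H : set (T * T * T)) : G `<=` H -> fld G `<=` fld H.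
Proof. by move=> GH x [z Gz]; exists z; exact: GH. Qed.

Lemma sq_bigcup (F : set (set (T * T * T))) :
  F `<=` sq -> total_on F subset -> sq (\bigcup_(X in F) X).
Proof.
move=> Fsq totF; split.
- move=> p q [X FX Xp] [Y FY Yq]; have [XY|YX] := totF _ _ FX FY.
    by have [+ _ _] := Fsq _ FY; apply => //; exact: XY.
  by have [+ _ _] := Fsq _ FX; apply => //; exact: YX.
- move=> x y z [X FX Xp]; have [_ + _] := Fsq _ FX => /(_ _ _ _ Xp)[? ? ?].
  by split; apply: (fldS (G := X)) => //; exact: bigcup_sup.
- move=> x y [u [X FX Xu]] [v [Y FY Yv]].
  have [XY|YX] := totF _ _ FX FY.
    have [_ _ /(_ x y)[]] := Fsq _ FY.
    + by exists u; exact: XY.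
    + by exists v.
    + by move=> z Yz; exists z, Y.
  have [_ _ /(_ x y)[]] := Fsq _ FX.
  + by exists u.
  + by exists v; exact: YX.
  + by move=> z Xz; exists z, X.
Qed.

(** The field X of [G] grows by its disjoint copy e(X). A new pair has a coordinate in the copy; it
    goes to the image under [e] of a code, computed in X by [G] itself, of the two originals and of
    which coordinates were copied. New values lie in e(X), so they avoid the old ones. *)
Lemma sq_extend (G : set (T * T * T)) (e : T -> T) (a0 a1 : T) : sq G ->
  fld G a0 -> fld G a1 -> a0 <> a1 ->
  (forall x, fld G x -> ~ fld G (e x)) ->
  {in fld G &, injective e} ->
  exists2 H, G `<` H & sq H /\ G `<=` H.
Proof.
move=> [Gfun Gfld Gtot] Ga0 Ga1 a01 efld einj.
have /choice[m mP] : forall p : T * T, exists z,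
    fld G p.1 -> fld G p.2 -> G (p.1, p.2, z).
  move=> [x y] /=; have [[Gx Gy]|nG] := pselect (fld G x /\ fld G y).
    by have [z Gz] := Gtot _ _ Gx Gy; exists z.
  by exists x => Gx Gy; exfalso; exact: nG.
have mG x y : fld G x -> fld G y -> fld G (m (x, y)).
  by move=> Gx Gy; have [] := Gfld _ _ _ (mP (x, y) Gx Gy).
have minj x y x' y' : fld G x -> fld G y -> fld G x' -> fld G y' ->
    m (x, y) = m (x', y') -> x = x' /\ y = y'.
  move=> Gx Gy Gx' Gy' em.
  by have /(_ em)[] := (Gfun _ _ (mP (x, y) Gx Gy) (mP (x', y') Gx' Gy')).2.
pose d (s : bool) u := if s then e u else u.
(* The tags [a0] and [a1] record in X whether a coordinate comes from the copy. *)
pose tg (s : bool) := if s then a1 else a0.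
have Gtg s : fld G (tg s) by case: s.
pose cod s t u v := m (m (tg s, tg t), m (u, v)).
have Gcod s t u v : fld G u -> fld G v -> fld G (cod s t u v).
  by move=> Gu Gv; apply: (mG); apply: (mG).
have dinj s t u v : fld G u -> fld G v -> d s u = d t v -> s = t /\ u = v.
  case: s t => -[] //= Gu Gv duv.
  - by split=> //; apply: einj; rewrite ?inE.
  - by exfalso; apply: (efld _ Gu); rewrite duv.
  - by exfalso; apply: (efld _ Gv); rewrite -duv.
have tginj s t : tg s = tg t -> s = t.
  by case: s t => -[] //= E; exfalso; apply: a01.
have codinj s t u v s' t' u' v' : fld G u -> fld G v -> fld G u' ->
    fld G v' -> cod s t u v = cod s' t' u' v' ->
    [/\ s = s', t = t', u = u' & v = v'].
  move=> Gu Gv Gu' Gv' /minj[]; try by apply: (mG).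
  by move=> /minj[]// /tginj -> /tginj -> /minj[]// -> ->.
pose H := G `|` [set p | exists s t u v, [/\ s || t, fld G u, fld G v &
  p = (d s u, d t v, e (cod s t u v))]].
have GH : G `<=` H by move=> p; left.
have fldH x : fld H x <-> exists s u, fld G u /\ x = d s u.
  split=> [[z [Gz|[s [t [u [v [_ Gu Gv [-> _ _]]]]]]]]|[[] [u [Gu ->]]]].
  - by exists false, x; split=> //; exists z.
  - by exists s, u.
  - by exists (e (cod true true u u)); right; exists true, true, u, u.
  - exact: fldS GH _ Gu.
exists H.
  split=> // HG.
  have /HG/Gfld[+ _ _] : H (d true a0, d true a0, e (cod true true a0 a0)).
    by right; exists true, true, a0, a0.
  exact: efld.
split=> //; split.
- move=> p q [Gp|[s [t [u [v [st Gu Gv ->]]]]]]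
    [Gq|[s' [t' [u' [v' [st' Gu' Gv' ->]]]]]].
  + exact: Gfun.
  + case: p Gp => -[x y] z /= /Gfld[Gx Gy Gz]; split=> [[xE yE]|zE].
      exfalso; case: s' t' st' xE yE => -[]//= _ xE yE.
      * by apply: (efld _ Gu'); rewrite -xE.
      * by apply: (efld _ Gu'); rewrite -xE.
      * by apply: (efld _ Gv'); rewrite -yE.
    by exfalso; apply: (efld (cod s' t' u' v')); rewrite -?zE//; exact: Gcod.
  + case: q Gq => -[x y] z /= /Gfld[Gx Gy Gz]; split=> [[xE yE]|zE].
      exfalso; case: s t st xE yE => -[]//= _ xE yE.
      * by apply: (efld _ Gu); rewrite xE.
      * by apply: (efld _ Gu); rewrite xE.
      * by apply: (efld _ Gv); rewrite yE.
    by exfalso; apply: (efld (cod s t u v)); rewrite ?zE//; exact: Gcod.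
  + split=> /= [[/dinj[]// <- <- /dinj[]// <- <-]//|].
    by move=> /einj; rewrite !inE => /(_ (Gcod _ _ _ _ Gu Gv)
      (Gcod _ _ _ _ Gu' Gv')) /codinj[]// -> -> -> ->.
- move=> x y z [/Gfld[Gx Gy Gz]|]; first by split; exact: fldS GH _ _.
  move=> [s [t [u [v [st Gu Gv [-> -> ->]]]]]]; split; apply/fldH.
  + by exists s, u.
  + by exists t, v.
  + by exists true, (cod s t u v); split=> //; exact: Gcod.
- move=> x y /fldH[s [u [Gu ->]]] /fldH[t [v [Gv ->]]].
  have [st|] := boolP (s || t).
    by exists (e (cod s t u v)); right; exists s, t, u, v.
  case: s t => -[]//= _; have [z Gz] := Gtot _ _ Gu Gv.
  by exists z; left.
Qed.

Lemma square_embeds : embeds nat T -> embeds (T * T) T.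
Proof.
move=> [f finj].
pose G0 : set (T * T * T) := [set p | exists i j,
  p = (f i, f j, f (pickle (i, j)))].
have fld0 x : fld G0 x <-> exists i, x = f i.
  split=> [[z [i [j [-> _ _]]]]|[i ->]]; first by exists i.
  by exists (f (pickle (i, i))), i, i.
have sq0 : sq G0.
  split=> [_ _ [i [j ->]] [i' [j' ->]] /=|x y z [i [j [-> -> ->]]]|x y].
  - split=> [[/finj -> /finj ->]//|/finj/(pcan_inj pickleK)[-> ->]]//.
  - by split; apply/fld0; eexists.
  - by move=> /fld0[i ->] /fld0[j ->]; exists (f (pickle (i, j))), i, j.
have [|G [[->|[G0G sqG]] maxG]] :=
    @Zorn_bigcup _ [set G | G = set0 \/ G0 `<=` G /\ sq G].
- move=> F FP totF.
  have [[G [FG G0G]]|nF] := pselect (exists G, F G /\ G0 `<=` G); last first.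
    left; apply/seteqP; split=> // p [G FG Gp].
    have [GE|[G0G _]] := FP _ FG; first by rewrite GE in Gp.
    by case: nF; exists G.
  right; split; first by apply: subset_trans G0G _; exact: bigcup_sup.
  rewrite (_ : \bigcup_(_ in _) _ = \bigcup_(X in F `&` sq) X); last first.
    apply/seteqP; split=> p [X]; last by move=> [FX sqX] Xp; exists X.
    move=> FX Xp; exists X => //; split=> //.
    by have [XE|[]//] := FP _ FX; rewrite XE in Xp.
  by apply: sq_bigcup => [X [_ sqX]|X Y [FX _] [FY _]] //; exact: totF.
- have [] := maxG G0; last by right; split=> //; exact: sq0.
  by split=> // /(_ (f 0, f 0, f (pickle (0, 0)))); apply; exists 0, 0.
have [Gfun Gfld Gtot] := sqG.
have Gf i : fld G (f i) by apply: fldS G0G _ _; apply/fld0; exists i.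
have [[e einj]|[e einj]] :=
    embeds_total {x | fld G x} {x | ~ fld G x}.
  pose e' x := if pselect (fld G x) is left h then sval (e (exist _ x h)) else x.
  have [|x Gx|x y|H GH [sqH G0H]] := @sq_extend G e' (f 0) (f 1) sqG (Gf 0) (Gf 1).
  - by move=> /finj.
  - by rewrite /e'; case: pselect => // h; exact: (svalP (e _)).
  - rewrite !inE /e' => Gx Gy; case: pselect => // h; case: pselect => // k.
    by move=> /val_sigI/einj[].
  - have [] := maxG H GH; right; split=> //; exact: subset_trans G0H.
have /choice[m mP] : forall p : T * T, exists z,
    fld G p.1 -> fld G p.2 -> G (p.1, p.2, z).
  move=> [x y] /=; have [[Gx Gy]|nG] := pselect (fld G x /\ fld G y).
    by have [z Gz] := Gtot _ _ Gx Gy; exists z.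
  by exists x => Gx Gy; exfalso; exact: nG.
have mG x y : fld G x -> fld G y -> fld G (m (x, y)).
  by move=> Gx Gy; have [] := Gfld _ _ _ (mP (x, y) Gx Gy).
have minj x y x' y' : fld G x -> fld G y -> fld G x' -> fld G y' ->
    m (x, y) = m (x', y') -> x = x' /\ y = y'.
  move=> Gx Gy Gx' Gy' em.
  by have /(_ em)[] := (Gfun _ _ (mP (x, y) Gx Gy) (mP (x', y') Gx' Gy')).2.
pose j x := match pselect (fld G x) with
  | left _ => m (f 0, x)
  | right h => m (f 1, sval (e (exist _ x h))) end.
have Gj x : fld G (j x).
  by rewrite /j; case: pselect => h; apply: mG => //; exact: (svalP (e _)).
have jinj : injective j.
  move=> x y; rewrite /j; case: pselect => h; case: pselect => k /minj[] //;
    try exact: (svalP (e _)).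
  - by move=> /finj.
  - by move=> /finj.
  - by move=> _ /val_sigI/einj[].
exists (fun p => m (j p.1, j p.2)) => -[x y] [x' y'] /= /minj[]//.
by move=> /jinj -> /jinj ->.
Qed.

End Square.

Lemma embeds_seq (T : Type) : embeds nat T -> embeds (T * T) T ->
  embeds (seq T) T.
Proof.
move=> [f finj] [p pinj].
(* The length is stored beside the code, since the end mark [f 0] may itself be the value of a
   pair. *)
pose code := foldr (fun x c => p (x, c)) (f 0).
exists (fun s => p (f (size s), code s)) => s t /pinj[/finj].
elim: s t => [|x s IH] [|y t] //= [st] /pinj[->] /(IH _ st) -> //.
Qed.

Lemma card_le_embeds (A U : Type) (B : set U) :
  [set: A] #<= B <-> exists f : A -> U, injective f /\ forall a, B (f a).
Proof.
split=> [/card_leP[f]|[f [finj fB]]].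
  exists (fun a => \val (f (SigSub (in_setT a)))); split=> [x y /val_inj|x].
    by move=> /'inj_f; rewrite !inE => /(_ Logic.I Logic.I) [].
  exact: set_valP.
have /card_le_trans : [set: A] #<= f @` [set: A].
  have : f @` [set: A] #= [set: A] by apply: inj_card_eq => x y _ _; exact: finj.
  by rewrite card_eq_le => /andP[].
by apply; apply: subset_card_le => _ [a _ <-].
Qed.

Lemma small_range (K X U : Type) (B : set U) (g : X -> U) :
  ~ embeds K X -> B `<=` range g -> small K B.
Proof.
move=> nKX Bg /card_le_embeds[f [finj fB]]; apply: nKX.
have /choice[r rE] : forall k, exists x, g x = f k.
  by move=> k; have [x _ <-] := Bg _ (fB k); exists x.
by exists r => k k' /(congr1 g); rewrite !rE => /finj.
Qed.

(** [X] is the larger of [A] and the set of formulas. It absorbs pairs and formulas, so a set built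
    from [A] stays small as long as it is the range of a map from [X]. *)
Lemma small_carrier (K U : Type) (L : language) (A : set U) (u0 : U) :
  small K [set: form L nat] -> small K A ->
  exists X : Type, [/\ ~ embeds K X, embeds nat X, embeds (X * X) X,
    embeds (form L nat) X & exists g : X -> U, A `<=` range g].
Proof.
move=> Ksmall Asmall.
have nKF : ~ embeds K (form L nat).
  by move=> [f finj]; apply/Ksmall/card_le_embeds; exists f.
have nKA : ~ embeds K {u | A u}.
  move=> [f finj]; apply/Asmall/card_le_embeds; exists (sval \o f).
  by split=> [x y /val_sigI/finj//|x]; exact: (svalP (f x)).
have natF : embeds nat (form L nat).
  by exists (fun i => FEq (Var L i) (Var L i)) => i j [].
have [FA|AF] := embeds_total (form L nat) {u | A u}.
  exists {u | A u}.
  have natA := embeds_trans natF FA.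
  split=> //; first exact: square_embeds.
  by exists sval => u Au; exists (exist _ u Au).
exists (form L nat); split=> //; first exact: square_embeds.
  by exists id.
have [[u Au]|nA] := pselect (exists u, A u); last first.
  by exists (fun=> u0) => u Au; exfalso; apply: nA; exists u.
have [r rE] := embeds_onto (exist _ u Au) AF.
by exists (sval \o r) => v Av; have [y yE] := rE (exist _ v Av); exists y => //=;
  rewrite yE.
Qed.

Lemma embeds_sum (X : Type) : embeds nat X -> embeds (X * X) X ->
  embeds (X + X) X.
Proof.
move=> [f finj] [p pinj].
exists (fun v => match v with inl x => p (f 0, x) | inr x => p (f 1, x) end).
by move=> [x|x] [y|y] /pinj[] // => [->//|/finj//|/finj//|->].
Qed.

Lemma range_setU (X U : Type) (A B : set U) (g h : X -> U) :
  embeds nat X -> embeds (X * X) X -> A `<=` range g -> B `<=` range h ->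
  exists k : X -> U, A `|` B `<=` range k.
Proof.
move=> natX XX Ag Bh; have [f _] := natX.
have [r rE] := embeds_onto (inl (f 0)) (embeds_sum natX XX).
exists (fun x => match r x with inl y => g y | inr y => h y end).
move=> u [/Ag[x _ <-]|/Bh[x _ <-]].
  by have [y yE] := rE (inl x); exists y; rewrite ?yE.
by have [y yE] := rE (inr x); exists y; rewrite ?yE.
Qed.

Lemma finite_range (X U : Type) (B : set U) (u0 : U) :
  embeds nat X -> finite_set B -> exists h : X -> U, B `<=` range h.
Proof.
move=> natX /finite_set_countable/countable_injP[f finj].
have BX : embeds {u | B u} X.
  apply: embeds_trans natX; exists (f \o sval) => u v /finj.
  by rewrite !inE => /(_ (svalP u) (svalP v)) /val_sigI.
have [[u Bu]|nB] := pselect (exists u, B u); last first.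
  by exists (fun=> u0) => u Bu; exfalso; apply: nB; exists u.
have [r rE] := embeds_onto (exist _ u Bu) BX.
by exists (sval \o r) => v Bv; have [y yE] := rE (exist _ v Bv); exists y => //=;
  rewrite yE.
Qed.

Lemma small_setU_finite (K U : Type) (L : language) (u0 : U) (A B : set U) :
  small K [set: form L nat] -> small K A -> finite_set B -> small K (A `|` B).
Proof.
move=> Ksmall Asmall finB.
have [X [nKX natX XX _ [g Ag]]] := small_carrier u0 Ksmall Asmall.
have [h Bh] := finite_range u0 natX finB.
have [k ABk] := range_setU natX XX Ag Bh.
exact: small_range ABk.
Qed.

End Cardinals.

(** * The downward Loewenheim-Skolem theorem, with control of the size *)

Section LowenheimSkolem.
Context (L : language) (U : Type) (S : structure L U).

Lemma tarski_vaught (N : set U) :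
  (exists u, N u) ->
  (forall q : pform L U unit, over N q -> (exists a, holds S q a) ->
     exists d, N d /\ holds S q (fun=> d)) ->
  elementary_sub S N.
Proof.
move=> [u0 Nu0] NTV.
have Nfun f (s : 'I_(farity f) -> N) : N (fint S (\val \o s)).
  (* Closure under functions is the test for the formula x = f(s). *)
  pose q : pform L U unit := FEq (Var L (inl tt))
    (App (fun i => Var L (inr (\val (s i))))).
  have [||d [Nd]] := NTV q; last by rewrite /holds /= => <-.
    by move=> u /= [|[i [->]]] //; exact: set_valP.
  by exists (fun=> fint S (\val \o s)).
pose SN : structure L N := Structure
  (fun f s => SigSub (mem_set (Nfun f s)) : N)
  (fun r s => rint S (\val \o s)) (inhabits (SigSub (mem_set Nu0) : N)).
have tevalE (V : Type) (e : V -> N) (t : term L V) :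
    \val (teval SN e t) = teval S (\val \o e) t.
  by elim: t => [//|f s IH] /=; congr fint; apply: funext => i /=; exact: IH.
exists SN.
suff H (V : Type) (phi : form L V) (e : V -> N) :
    sat SN e phi <-> sat S (\val \o e) phi by move=> n phi a; exact: H.
elim: phi e => /= [{}V s t|{}V r s|{}V p IH|{}V p IHp q IHq|{}V p IH] e.
- by rewrite -!tevalE; split=> [->//|/val_inj].
- by rewrite (_ : \val \o _ = fun i => teval S (\val \o e) (s i))//;
    apply: funext => i /=; exact: tevalE.
- by rewrite IH.
- by rewrite IHp IHq.
- split=> [[d]|[d pd]].
    rewrite IH => pd; exists (\val d); move: pd.
    by congr sat; apply: funext => -[].
  pose h (o : option V) : (unit + U)%type :=
    if o is Some v then inr (\val (e v)) else inl tt.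
  have [||d' [Nd']] := NTV (fren h p).
  + move=> u; rewrite fv_fren => -[[v|] _] //= [<-]; exact: set_valP.
  + exists (fun=> d); rewrite /holds sat_fren; move: pd.
    by congr sat; apply: funext => -[].
  + rewrite /holds sat_fren => pd'; exists (SigSub (mem_set Nd')).
    by rewrite IH; move: pd'; congr sat; apply: funext => -[].
Qed.

(** All stages share the index type [X]: an element decodes either to an old index or to a formula
    with a list of indices, and in the second case its value at the next stage is a chosen
    witness. *)
Lemma lowenheim_skolem (X : Type) (g : X -> U) :
  embeds nat X -> embeds (X * X) X -> embeds (form L nat) X ->
  exists h : X -> U, range g `<=` range h /\ elementary_sub S (range h).
Proof.
move=> natX XX FX; have [f _] := natX; have [u0] := dom_inhabited S.
(* Variable 0 is the one to be witnessed; variable j+1 is the j-th parameter. *)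
pose env (w : seq U) d i := if i is j.+1 then nth u0 w j else d.
have /choice[wit witP] : forall p : form L nat * seq U, exists d,
    (exists d', sat S (env p.2 d') p.1) -> sat S (env p.2 d) p.1.
  move=> p; have [[d pd]|np] := pselect (exists d', sat S (env p.2 d') p.1).
    by exists d.
  by exists u0 => /np.
have prodX (A B : Type) : embeds A X -> embeds B X -> embeds (A * B) X.
  move=> [i iinj] [j jinj]; apply: embeds_trans XX.
  by exists (fun p => (i p.1, j p.2)) => -[a b] [a' b'] /= [/iinj-> /jinj->].
have XE : embeds (X + form L nat * seq X) X.
  have [i iinj] := prodX _ _ FX (embeds_seq natX XX).
  apply: embeds_trans (embeds_sum natX XX).
  by exists (fun v => match v with inl x => inl x | inr y => inr (i y) end)
    => -[x|x] [y|y] [] // => [->|/iinj->].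
have [dec decP] := embeds_onto (inl (f 0)) XE.
pose step (k : X -> U) x :=
  match dec x with inl y => k y | inr (phi, w) => wit (phi, map k w) end.
pose G n := iter n step g.
have GS n : range (G n) `<=` range (G n.+1).
  by move=> _ [x _ <-]; have [y yE] := decP (inl x); exists y => //=;
    rewrite {1}/step yE.
have Gle m n : (m <= n)%N -> range (G m) `<=` range (G n).
  move=> /subnK <-; elim: (n - m)%N => // k IH; rewrite addSn.
  exact: subset_trans (GS _).
(* Since [nat * X] embeds in [X], the union of all stages is again the range of a map from [X]. *)
have [r rP] := embeds_onto (0, f 0) (prodX _ _ natX (ex_intro _ id (@inj_id X))).
pose h x := G (r x).1 (r x).2.
have hP u : range h u <-> exists n, range (G n) u.
  split=> [[x _ <-]|[n [x _ <-]]]; first by exists (r x).1, (r x).2.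
  by have [y yE] := rP (n, x); exists y; rewrite // /h yE.
exists h; split; first by move=> u gu; apply/hP; exists 0.
apply: tarski_vaught => [|q hq [a qa]]; first by exists (h (f 0)), (f 0).
have [k [q' [c [qE cP]]]] := param_fin (h (f 0)) q.
have hc i : range h (c i) by have [/hq//|->] := cP i; exists (f 0).
(* The stages increase and there are finitely many parameters, so one stage contains them all. *)
have [n nP] : exists n, forall i, range (G n) (c i).
  have /choice[l lP] := fun i => (hP (c i)).1 (hc i).
  exists (\max_i l i) => i; apply: Gle (lP i); exact: leq_bigmax.
have /choice[x xP] : forall i, exists x, G n x = c i.
  by move=> i; have [x _ <-] := nP i; exists x.
pose w := [seq x i | i <- enum 'I_k].
pose phi : form L nat := fren (fun v : unit + 'I_k =>
  match v with inl _ => 0 | inr i => i.+1 end) q'.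
have satE d : sat S (env (map (G n) w) d) phi <-> holds S q (fun=> d).
  rewrite qE holds_inst sat_fren.
  rewrite (_ : _ \o _ = fun v => match v with inl _ => d | inr j => c j end)//.
  apply: funext => -[//|i] /=; rewrite -map_comp.
  by rewrite (nth_map i) ?size_enum_ord// nth_ord_enum /= xP.
have [y yE] := decP (inr (phi, w)).
exists (wit (phi, map (G n) w)); split.
  by apply/hP; exists n.+1, y => //=; rewrite /step yE.
apply/satE; apply: (witP (phi, _)); exists (a tt); apply/satE.
by rewrite (_ : (fun=> a tt) = a)//; apply: funext => -[].
Qed.

Lemma ex_model_around (K : Type) (M : set U) (I : Type) (phi : pform L U I) :
  small K [set: form L nat] -> small K M -> exists N, model_around S K M phi N.
Proof.
move=> Ksmall Msmall; have [u0] := dom_inhabited S.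
have [X [nKX natX XX FX [g Mg]]] := small_carrier u0 Ksmall Msmall.
have [h phih] := finite_range u0 natX (finite_params phi).
have [k Mk] := range_setU natX XX Mg phih.
have [l [kl lS]] := lowenheim_skolem k natX XX FX.
exists (range l); split => //.
- exact: (small_range (g := l) nKX).
- by move=> u Mu; apply: kl; apply: Mk; left.
- by move=> u phiu; apply: kl; apply: Mk; right.
Qed.

End LowenheimSkolem.

Local Open Scope ring_scope.

(** * Type spaces *)

Section Types.
Context (L : language) (U : Type) (S : structure L U).

Section TypesOver.
Variables (A : set U) (I : Type).
Implicit Types (p q : ctype S A I) (phi psi : pform L U I) (a c : I -> U).

Lemma ctype_not p phi : over A phi -> p (FNot phi) <-> ~ p phi.
Proof.
move=> Aphi; split=> [pn pp|np]; last by case: (ctype_complete p Aphi).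
have [||a aP] := @ctype_fsat _ _ _ _ _ p [set phi; FNot phi].
- exact: finite_set2.
- by move=> ? [->|->].
- by have /= := aP _ (or_intror erefl); apply; apply: aP; left.
Qed.

(** Finite satisfiability of the literals that [p] decides. It allows relations between finitely
    many formulas to be checked on points of the model instead of types. *)
Lemma ctype_approx (p : ctype S A I) (B : finType) (chi : B -> pform L U I) :
  (forall b, over A (chi b)) ->
  exists a, forall b, p (chi b) <-> holds S (chi b) a.
Proof.
move=> Achi.
pose f b := if pselect (p (chi b)) then chi b else FNot (chi b).
have [||a aP] := @ctype_fsat _ _ _ _ _ p (range f).
- by apply: finite_image; exact: finite_finset.
- move=> _ [b _ <-]; rewrite /f; case: pselect => // np.
  exact/(ctype_not _ (Achi b)).
exists a => b; have := aP (f b) (imageP _ Logic.I); rewrite /f.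
by case: pselect => /= pb; split.
Qed.

Lemma ctype_ext p q : (forall phi, over A phi -> p phi <-> q phi) -> p = q.
Proof.
case: p q => [p po pf pc] [q qo qf qc] /= pq.
have E : p = q.
  apply: funext => phi; apply: propext; split=> h.
    by apply/pq => //; exact: po.
  by apply/pq => //; exact: qo.
by subst q; congr CType; exact: Prop_irrelevance.
Qed.

Lemma realizesP p a phi : realizes p a -> over A phi -> p phi <-> holds S phi a.
Proof.
move=> pa Aphi; split=> [/pa//|h].
have [//|/pa] := ctype_complete p Aphi; exact.
Qed.

Lemma realizes_tp a : realizes (tp S A a) a.
Proof. by move=> phi []. Qed.

Lemma realizes_eq p a : realizes p a -> p = tp S A a.
Proof.
move=> pa; apply: ctype_ext => phi Aphi; rewrite (realizesP pa)//=.
by split=> // -[].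
Qed.

Lemma realizes_same p a c : realizes p a -> realizes p c -> same_type S A a c.
Proof. by move=> pa pb phi Aphi; rewrite -!(realizesP (p := p)). Qed.

End TypesOver.

Lemma tresE (A B : set U) (AB : A `<=` B) (I : Type) (p : ctype S B I) phi :
  over A phi -> tres AB p phi <-> p phi.
Proof. by move=> Aphi; split=> [[]|]. Qed.

Lemma ctype_realized (K : Type) (A : set U) (I : finType) (p : ctype S A I) :
  saturated K S -> small K A -> exists a, realizes p a.
Proof.
move=> satS smallA.
pose h := @enum_val I predT.
have Ah phi : over A (pren h phi) -> over A phi.
  move=> Aphi u phiu; apply: Aphi; rewrite /pren fv_fren.
  by exists (inr u).
pose q phi := p (pren h phi).
have qover phi : q phi -> over A phi by move=> /ctype_over /Ah.
have qfsat X : finite_set X -> X `<=` q ->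
    exists a, forall phi, X phi -> holds S phi a.
  move=> finX Xp; have [||a aP] := @ctype_fsat _ _ _ _ _ p (pren h @` X).
  - exact: finite_image.
  - by move=> _ [phi /Xp pphi <-].
  - by exists (a \o h) => phi Xphi; apply/holds_pren; apply: aP; exists phi.
have qcomplete phi : over A phi -> q phi \/ q (FNot phi).
  by move=> Aphi; apply: (ctype_complete p); exact: over_pren.
have [a aP] := satS A _ (CType qover qfsat qcomplete) smallA.
exists (a \o enum_rank) => phi pphi.
apply/(@holds_pren _ _ _ _ _ enum_rank); apply: aP => /=.
rewrite /q pren_comp (_ : _ \o _ = id) ?pren_id//.
by apply: funext => i /=; rewrite /h enum_rankK.
Qed.

Definition FFalse (I : Type) : pform L U I :=
  FNot (FEx (FEq (Var L None) (Var L None))).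

Definition FOrs (I : Type) (B : Type) (chi : B -> pform L U I) (s : seq B) :
    pform L U I :=
  foldr (fun b psi => FNot (FAnd (FNot (chi b)) (FNot psi))) (FFalse I) s.

Lemma over_FFalse (A : set U) I : over A (FFalse I).
Proof. by move=> u [//|]. Qed.

Lemma over_FOrs (A : set U) (I B : Type) (chi : B -> pform L U I) (s : seq B) :
  (forall b, over A (chi b)) -> over A (FOrs chi s).
Proof.
move=> Achi; elim: s => [|b s IH] /=; first exact: over_FFalse.
by move=> u [/Achi|/IH].
Qed.

Lemma holds_FOrs (I : Type) (B : eqType) (chi : B -> pform L U I) (s : seq B) a :
  holds S (FOrs chi s) a <-> exists2 b, b \in s & holds S (chi b) a.
Proof.
elim: s => [|b s IH].
  split=> [|[b]]; last by rewrite in_nil.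
  by have [u] := dom_inhabited S; case; exists u.
rewrite [holds _ _ _]/(~ (~ holds S (chi b) a /\ ~ holds S (FOrs chi s) a)) IH.
split=> [/not_andP[/contrapT bs|/contrapT[c cs pc]]|[c]].
- by exists b; rewrite ?mem_head.
- by exists c; rewrite // in_cons cs orbT.
- rewrite in_cons => /predU1P[->|cs] pc [nb nc]; first exact: nb.
  by apply: nc; exists c.
Qed.

Lemma ctype_FOrs (A : set U) (I : Type) (p : ctype S A I) (B : choiceType)
    (chi : B -> pform L U I) (s : seq B) : (forall b, over A (chi b)) ->
  p (FOrs chi s) <-> exists2 b, b \in s & p (chi b).
Proof.
move=> Achi.
pose f (o : option (seq_sub s)) := if o is Some b then chi (val b) else FOrs chi s.
have [|a aP] := @ctype_approx A I p _ f.
  by move=> [b|]; [exact: Achi|exact: over_FOrs].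
have /= -> := aP None; rewrite holds_FOrs; split=> -[b bs h]; exists b => //.
  exact/(aP (Some (SeqSub bs))).
exact/(aP (Some (SeqSub bs))).
Qed.

(** Used to turn a threshold on an average of truth values into a formula, by disjunctive normal
    form. *)
Lemma bool_comb (I : Type) (B : finType) (chi : B -> pform L U I)
    (G : pred {ffun B -> bool}) :
  exists psi, forall a,
    holds S psi a <-> G [ffun b => `[< holds S (chi b) a >]].
Proof.
(* [lit v b] is the literal that [v] makes false, so the negated disjunction of these literals says
   that [v] is the actual truth assignment. *)
pose lit (v : {ffun B -> bool}) b := if v b then FNot (chi b) else chi b.
pose psi := FOrs (fun v => FNot (FOrs (lit v) (enum B))) (enum G).
exists psi => a; rewrite holds_FOrs; split=> [[v]|Ga].
  rewrite mem_enum => Gv /= H.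
  have {}H b : ~ holds S (lit v b) a.
    move=> hb; apply: H; apply: (holds_FOrs (lit v) (enum B) a).2.
    by exists b; rewrite ?mem_enum.
  rewrite (_ : finfun _ = v)//; apply/ffunP => b; rewrite ffunE.
  apply/asboolP/idP => [hb|vb]; apply: contrapT => nb; apply: (H b).
    by rewrite /lit; case: (v b) nb.
  by rewrite /lit vb.
exists [ffun b => `[< holds S (chi b) a >]]; first by rewrite mem_enum.
move=> /holds_FOrs[b _]; rewrite /lit ffunE.
by case: asboolP => // hb; exact.
Qed.

Section Topology.
Variables (A : set U) (I : Type).

Lemma open_clop (phi : pform L U I) : open (clop phi : set (ctype S A I)).
Proof. by move=> p pphi; exists phi. Qed.

Lemma openP (O : set (ctype S A I)) (p : ctype S A I) : open O -> O p ->
  exists2 phi, p phi & clop phi `<=` O.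
Proof. by move=> oO; exact: oO. Qed.

Lemma ctype_hausdorff : hausdorff_space (ctype S A I).
Proof.
rewrite open_hausdorff => p q /eqP pq.
have [phi [Aphi [pphi nq]]] : exists phi, over A phi /\ p phi /\ ~ q phi.
  apply: contrapT => H; apply: pq; apply: ctype_ext => phi Aphi.
  split=> h; apply: contrapT => nh; apply: H.
    by exists phi.
  exists (FNot phi); split=> //; split; first exact/ctype_not.
  by move=> /ctype_not; apply.
exists (clop phi, clop (FNot phi)); first by split; rewrite inE//; exact/ctype_not.
split; [exact: open_clop|exact: open_clop|].
by apply/eqP/seteqP; split=> // r [/= rp /ctype_not]; apply => //; exact: ctype_over rp.
Qed.

Lemma compact_clop (C O : set (ctype S A I)) : compact C -> open O -> C `<=` O ->
  exists phi, [/\ over A phi, C `<=` clop phi & clop phi `<=` O].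
Proof.
move=> cC oO CO.
pose B : choiceType := {classic {phi : pform L U I | over A phi}}.
pose chi (b : B) : pform L U I := sval b.
have Achi b : over A (chi b) by exact: (svalP b).
have := cC; rewrite compact_cover => /(_ B [set b | clop (chi b) `<=` O]
  (fun b => clop (chi b)))[].
- by move=> b _; exact: open_clop.
- move=> p Cp; have [phi pphi phiO] := openP oO (CO _ Cp).
  by exists (exist _ phi (ctype_over pphi)).
move=> D DO CD; exists (FOrs chi (finmap.enum_fset D)); split.
- exact: over_FOrs.
- by move=> p /CD[b /= bD pb]; apply/ctype_FOrs => //; exists b.
- move=> p /ctype_FOrs[]// b bD pb.
  by have := DO _ bD; rewrite inE; apply.
Qed.

End Topology.

Lemma tres_continuous (A B : set U) (AB : A `<=` B) (I : Type) :
  continuous (tres AB (I := I) : ctype S B I -> ctype S A I).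
Proof.
apply/continuousP => O oO.
suff : ctype_open (tres AB (I := I) @^-1` O) by [].
move=> p Op; have [phi pphi phiO] := openP oO Op.
have Aphi := ctype_over pphi.
exists phi; first exact/(tresE AB).
by move=> q qphi; apply: phiO; exact/tresE.
Qed.

Lemma measurable_open (A : set U) (I : Type) (O : set (ctype S A I)) :
  open O -> measurable (O : set (borel_ctype S A I)).
Proof. by move=> oO; apply: sub_sigma_algebra. Qed.

Lemma measurable_compact (A : set U) (I : Type) (C : set (ctype S A I)) :
  compact C -> measurable (C : set (borel_ctype S A I)).
Proof.
move=> /(compact_closed (@ctype_hausdorff A I)) /closed_openC oC.
by rewrite -[C]setCK; apply: measurableC; exact: measurable_open.
Qed.

Lemma measurable_tres (A B : set U) (AB : A `<=` B) (I : Type) :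
  measurable_fun [set: borel_ctype S B I]
    (tres AB (I := I) : borel_ctype S B I -> borel_ctype S A I).
Proof.
apply: (@measurability _ _ (borel_ctype S B I) (borel_ctype S A I) setT _
  (@open (ctype S A I))) => //.
move=> _ [V oV <-]; rewrite setTI; apply: measurable_open.
by move/continuousP: (@tres_continuous A B AB I); apply.
Qed.

End Types.

(** * Measures *)

Section BoundedIntegrals.
Context d (T : measurableType d) (R : realType) (P : probability T R).
Implicit Types (f g : T -> R).

Lemma integrable_bounded f (c : R) : measurable_fun [set: T] f ->
  (forall x, `|f x| <= c) -> P.-integrable [set: T] (EFin \o f).
Proof.
move=> mf fc; apply: measurable_bounded_integrable => //.
  by rewrite (le_lt_trans (probability_le1 P measurableT))// ltry.
exists c; split; first exact: num_real.
by move=> y cy x _ /=; rewrite (le_trans (fc x))// ltW.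
Qed.

Lemma Rintegral_EFin f (c : R) : measurable_fun [set: T] f ->
  (forall x, `|f x| <= c) ->
  (\int[P]_x (f x)%:E)%E = (\int[P]_x f x)%:E.
Proof.
move=> mf fc; rewrite /Rintegral fineK//.
by apply: integrable_fin_num => //; exact: integrable_bounded mf fc.
Qed.

Lemma Rintegral_indic (A : set T) : measurable A ->
  \int[P]_x \1_A x = fine (P A).
Proof. by move=> mA; rewrite /Rintegral integral_indic// setIT. Qed.

Lemma Rintegral_cst1 (c : R) : \int[P]_x (cst c x) = c.
Proof. by rewrite (@Rintegral_cst _ _ _ P)// [X in fine X]probability_setT mulr1. Qed.

Lemma le_Rintegral_bounded f g (c e : R) :
  measurable_fun [set: T] f -> (forall x, `|f x| <= c) ->
  measurable_fun [set: T] g -> (forall x, `|g x| <= c) ->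
  (forall x, f x <= g x + e) -> \int[P]_x f x <= \int[P]_x g x + e.
Proof.
move=> mf fc mg gc fg.
have ifc := integrable_bounded mf fc.
have ig := integrable_bounded mg gc.
have ie : P.-integrable [set: T] (EFin \o cst e).
  exact: (@integrable_bounded _ `|e|).
rewrite -[X in _ <= _ + X]Rintegral_cst1 -RintegralD//.
apply: le_Rintegral => //.
by have := integrableD measurableT ig ie.
Qed.

Lemma Rintegral_near f g (c e : R) :
  measurable_fun [set: T] f -> (forall x, `|f x| <= c) ->
  measurable_fun [set: T] g -> (forall x, `|g x| <= c) ->
  (forall x, `|f x - g x| <= e) -> `|\int[P]_x f x - \int[P]_x g x| <= e.
Proof.
move=> mf fc mg gc fg; rewrite ler_distlC; apply/andP; split.
  rewrite lerBlDr; apply: (le_Rintegral_bounded mf fc mg gc) => x.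
  by have := fg x; rewrite ler_distlC => /andP[+ _]; rewrite lerBlDr.
apply: (le_Rintegral_bounded mg gc mf fc) => x.
by have := fg x; rewrite ler_distlC => /andP[].
Qed.

Lemma le_Rintegral_off f g (W : set T) (e : R) :
  measurable_fun [set: T] f -> (forall x, 0 <= f x <= 1) ->
  measurable_fun [set: T] g -> (forall x, 0 <= g x <= 1) ->
  measurable W -> (forall x, ~ W x -> f x <= g x + e) -> 0 <= e ->
  \int[P]_x f x <= \int[P]_x g x + fine (P W) + e.
Proof.
move=> mf f01 mg g01 mW fg e0.
have ig : P.-integrable [set: T] (EFin \o g).
  apply: (@integrable_bounded _ 1) => // x.
  by rewrite ger0_norm; have /andP[] := g01 x.
have mi : measurable_fun [set: T] (\1_W : T -> R) by exact: measurable_indic.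
have iw : P.-integrable [set: T] (EFin \o (\1_W : T -> R)).
  exact: integrable_indic.
rewrite -Rintegral_indic// -RintegralD//.
apply: (@le_Rintegral_bounded _ _ 2) => //.
- move=> x; have /andP[f0 f1] := f01 x; rewrite ger0_norm//.
  by rewrite (le_trans f1)// ler1n.
- exact: measurable_funD.
- move=> x; have /andP[g0 g1] := g01 x.
  rewrite /= indicE ger0_norm; last by rewrite addr_ge0.
  by rewrite (_ : 2 = 1 + 1)// lerD// lern1; case: (_ \in _).
- move=> x; rewrite indicE; case: (boolP (x \in W)) => [_|/negP xW] /=.
    have /andP[_ f1] := f01 x; have /andP[g0 _] := g01 x.
    by rewrite (le_trans f1)// addrAC lerDr addr_ge0.
  by rewrite addr0; apply: fg => Wx; apply: xW; rewrite inE.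
Qed.

Lemma Rintegral01 f : measurable_fun [set: T] f -> (forall x, 0 <= f x <= 1) ->
  0 <= \int[P]_x f x <= 1.
Proof.
move=> mf f01; apply/andP; split.
  by apply: Rintegral_ge0 => x _; have /andP[] := f01 x.
rewrite -[leRHS]Rintegral_cst1 -[leRHS]addr0.
apply: (@le_Rintegral_bounded _ _ 1) => // x.
- by rewrite ger0_norm; have /andP[] := f01 x.
- by rewrite normr1.
- by rewrite addr0; have /andP[] := f01 x.
Qed.

(** [g] is the pointwise infimum of a minimizing sequence of Borel majorants of [f]. The last clause
    says that each set where [f] exceeds [g - e] has full outer measure; it is phrased through Borel
    sets [B] in the complement because that set need not be measurable. *)
Lemma upper_envelope f : (forall x, 0 <= f x <= 1) ->
  exists g, [/\ measurable_fun [set: T] g, forall x, 0 <= g x <= 1,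
    forall x, f x <= g x &
    forall (B : set T) (e : R), measurable B -> 0 < e ->
      (forall x, B x -> f x <= g x - e) -> fine (P B) = 0].
Proof.
move=> f01.
pose D (g : T -> R) := [/\ measurable_fun [set: T] g,
  forall x, 0 <= g x <= 1 & forall x, f x <= g x].
pose W : set R := [set r | exists2 g, D g & r = \int[P]_x g x].
have W0 : has_inf W.
  split; first exists (\int[P]_x cst 1 x), (cst 1) => //.
    by split=> // x; [rewrite ler01 lexx|have /andP[] := f01 x].
  exists 0 => _ [g [mg g01 _] ->].
  by have /andP[] := Rintegral01 mg g01.
have /choice[h hP] : forall k : nat, exists g, D g /\
    \int[P]_x g x < inf W + k.+1%:R^-1.
  move=> k; have k0 : (0 : R) < k.+1%:R^-1 by rewrite invr_gt0.
  by have [_ [g Dg ->] ?] := inf_adherent k0 W0; exists g.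
pose g x := infs (h^~ x) 0.
have mh k : measurable_fun [set: T] (h k) by have [[]] := hP k.
have h01 k x : 0 <= h k x <= 1 by have [[]] := hP k.
have fh k x : f x <= h k x by have [[]] := hP k.
have lbh x : lbound (range (h^~ x)) (f x) by move=> _ [k _ <-].
have gE x : g x = inf (range (h^~ x)).
  by rewrite /g /infs /sdrop; congr inf; apply/seteqP; split=> _ [k _ <-]; exists k.
have gh k x : g x <= h k x.
  by rewrite gE; apply: ge_inf; [exists (f x)|exists k].
have fg x : f x <= g x.
  by rewrite gE; apply: lb_le_inf; [exists (h 0 x), 0|].
have g01 x : 0 <= g x <= 1.
  rewrite (le_trans _ (fg x))/=; last by have /andP[] := f01 x.
  by rewrite (le_trans (gh 0 x))//; have /andP[] := h01 0 x.
have mg : measurable_fun [set: T] g.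
  by apply: measurable_fun_infs => // x _; exists (f x).
have norm01 (k : T -> R) : (forall x, 0 <= k x <= 1) -> forall x, `|k x| <= 1.
  by move=> k01 x; rewrite ger0_norm; have /andP[] := k01 x.
have gW : \int[P]_x g x <= inf W.
  apply/ler_addgt0Pr => e e0.
  have [k ke] : exists k : nat, k.+1%:R^-1 <= e.
    exists (Num.truncn e^-1); rewrite invf_ple ?posrE// ltW//.
    exact: truncnS_gt.
  rewrite (@le_trans _ _ (\int[P]_x h k x))//.
    rewrite -[leRHS]addr0; apply: (le_Rintegral_bounded mg (norm01 _ g01)) => //.
      exact: norm01 (h01 k).
    by move=> x; rewrite addr0.
  by have [_ /ltW/le_trans] := hP k; apply; rewrite lerD2l.
exists g; split=> // B e mB e0 Bfg.
have mi : measurable_fun [set: T] (\1_B : T -> R) by exact: measurable_indic.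
have miB : measurable_fun [set: T] (fun x => e * \1_B x).
  exact: measurable_funM.
(* Lowering [g] by [e] on [B] leaves a Borel majorant of [f], whose integral cannot drop below the
   infimum. *)
pose k x := g x - e * \1_B x.
have fk x : f x <= k x.
  rewrite /k indicE; case: (boolP (x \in B)) => [|_] /=.
    by rewrite inE mulr1; exact: Bfg.
  by rewrite mulr0 subr0.
have Dk : D k.
  split=> // [|x]; first exact: measurable_funB.
  rewrite (le_trans _ (fk x))/=; last by have /andP[] := f01 x.
  have /andP[_ g1] := g01 x.
  by rewrite (le_trans _ g1)// lerBlDr lerDl mulr_ge0// ltW.
have : inf W <= \int[P]_x k x by apply: ge_inf; [have [] := W0|exists k].
have iB : P.-integrable [set: T] (EFin \o (\1_B : T -> R)).
  exact: integrable_indic.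
rewrite /k RintegralB//.
- rewrite RintegralZl// Rintegral_indic// => H.
  have : e * fine (P B) <= 0 by move: (le_trans gW H); rewrite lerBrDr gerDl.
  rewrite pmulr_rle0// => PB; apply/eqP; rewrite eq_le PB/=.
  exact: fine_ge0.
- exact: integrable_bounded mg (norm01 _ g01).
- apply: (@integrable_bounded _ e) => // x.
  rewrite ger0_norm; last by rewrite mulr_ge0// ltW.
  by rewrite ger_pMr// indicE lern1; case: (_ \in _).
Qed.

End BoundedIntegrals.

(** * Keisler measures: values at formulas, restrictions, clopen approximation *)

Section KeislerMeasures.
Context (R : realType) (L : language) (U : Type) (S : structure L U).

Lemma Rintegral_simple d (T : measurableType d) (P : probability T R)
    (B : Type) (s : seq B) (c : B -> R) (E : B -> set T) :
  (forall b, measurable (E b)) ->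
  let f x := \sum_(b <- s) c b * \1_(E b) x in
  [/\ measurable_fun [set: T] f,
      forall x, `|f x| <= \sum_(b <- s) `|c b| &
      \int[P]_x f x = \sum_(b <- s) c b * fine (P (E b))].
Proof.
move=> mE f; rewrite {}/f; elim: s => [|b s [mf fc fI]].
  split=> [|x|]; rewrite ?big_nil ?normr0//.
    by under eq_fun do rewrite big_nil; exact: measurable_cst.
  by under eq_Rintegral do rewrite big_nil; exact: Rintegral_cst1.
have mb : measurable_fun [set: T] (fun x => c b * \1_(E b) x : R).
  by apply: measurable_funM => //; exact: measurable_indic.
have mbc x : `|c b * \1_(E b) x| <= `|c b|.
  rewrite normrM ler_piMr// indicE; case: (_ \in _); rewrite ?normr1 ?normr0//.
split=> [|x|].
- by under eq_fun do rewrite big_cons; exact: measurable_funD.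
- by rewrite !big_cons (le_trans (ler_normD _ _))// lerD.
- under eq_Rintegral do rewrite big_cons.
  rewrite RintegralD//; last 2 first.
  + exact: integrable_bounded mb mbc.
  + exact: integrable_bounded mf fc.
  rewrite big_cons fI RintegralZl//; last exact: integrable_indic.
  by rewrite Rintegral_indic.
Qed.

Section Values.
Context (I : Type).
Implicit Types (mu : keisler R S I) (phi : pform L U I).

Definition truth (J : Type) (phi : pform L U J) (a : J -> U) : R :=
  `[< holds S phi a >]%:R.

Lemma truth_ge0 (J : Type) (phi : pform L U J) a : 0 <= truth phi a.
Proof. exact: ler0n. Qed.

Lemma truth_le1 (J : Type) (phi : pform L U J) a : truth phi a <= 1.
Proof. by rewrite lern1; case: asboolP. Qed.

Lemma truth1 (J : Type) (phi : pform L U J) a : holds S phi a -> truth phi a = 1.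
Proof. by move=> h; rewrite /truth asboolT. Qed.

Lemma truth0 (J : Type) (phi : pform L U J) a : ~ holds S phi a -> truth phi a = 0.
Proof. by move=> h; rewrite /truth asboolF. Qed.

Lemma eq_truth (J J' : Type) (phi : pform L U J) (psi : pform L U J') a a' :
  (holds S phi a <-> holds S psi a') -> truth phi a = truth psi a'.
Proof. by move=> h; rewrite /truth (asbool_equiv_eq h). Qed.

Lemma measurable_clop (A : set U) phi :
  measurable (clop phi : set (borel_ctype S A I)).
Proof. by apply: measurable_open; exact: open_clop. Qed.

(** Integrate the pointwise inequality over the global types: on the finitely many formulas
    involved, each type agrees with some point of the model ([ctype_approx]). *)
Lemma kval_le mu (B : finType) (c : B -> R) (chi : B -> pform L U I) (k : R) :
  (forall a, \sum_b c b * truth (chi b) a <= k) ->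
  \sum_b c b * kval mu (chi b) <= k.
Proof.
move=> H.
pose E b : set (borel_ctype S setT I) := clop (chi b).
have [mf fc fI] := Rintegral_simple (kmeas mu) (index_enum B) c (E := E)
  (fun b => measurable_clop (chi b)).
rewrite (_ : \sum_b _ = \int[kmeas mu]_x (\sum_b c b * \1_(E b) x))//.
rewrite -[leRHS](Rintegral_cst1 (kmeas mu)) -[leRHS]addr0.
apply: (@le_Rintegral_bounded _ _ _ _ _ _ (Num.max `|k| (\sum_b `|c b|))) => //.
- by move=> x; rewrite (le_trans (fc x))// le_max lexx orbT.
- by move=> x; rewrite le_max lexx.
- move=> p; rewrite addr0.
  have [|a aP] := @ctype_approx _ _ _ _ _ p B chi; first by [].
  apply: le_trans (H a); apply: ler_sum => b _.
  rewrite indicE /truth (_ : (p \in E b) = `[< holds S (chi b) a >])//.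
  by apply/idP/asboolP; rewrite inE => /(aP b).
Qed.

Lemma kval_ge mu (B : finType) (c : B -> R) (chi : B -> pform L U I) (k : R) :
  (forall a, k <= \sum_b c b * truth (chi b) a) ->
  k <= \sum_b c b * kval mu (chi b).
Proof.
move=> H; rewrite -lerN2 -sumrN; under eq_bigr do rewrite -mulNr.
apply: kval_le => a; under eq_bigr do rewrite mulNr.
by rewrite sumrN lerN2.
Qed.

Lemma kval_ge0 mu phi : 0 <= kval mu phi.
Proof. exact: fine_ge0. Qed.

Lemma kval_le1 mu phi : kval mu phi <= 1.
Proof.
have := @kval_le mu 'I_1 (fun=> 1) (fun=> phi) 1.
rewrite big_ord1 mul1r; apply => a; rewrite big_ord1 mul1r; exact: truth_le1.
Qed.

Lemma kval_gt0_holds mu phi : 0 < kval mu phi -> exists a, holds S phi a.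
Proof.
rewrite ltNge => /negP H; apply: contrapT => /forallNP n; apply: H.
have := @kval_le mu 'I_1 (fun=> 1) (fun=> phi) 0.
by rewrite big_ord1 mul1r; apply => a; rewrite big_ord1 mul1r truth0.
Qed.

Lemma kval_const mu phi (b : bool) : (forall a, holds S phi a <-> b) ->
  kval mu phi = b%:R.
Proof.
move=> H; have hE a : truth phi a = b%:R.
  by rewrite /truth (_ : `[< _ >] = b)//; apply/asboolP/idP => /H.
apply/eqP; rewrite eq_le.
have := @kval_le mu 'I_1 (fun=> 1) (fun=> phi) b%:R.
rewrite big_ord1 mul1r => -> /=; last by move=> a; rewrite big_ord1 mul1r hE.
have := @kval_ge mu 'I_1 (fun=> 1) (fun=> phi) b%:R.
by rewrite big_ord1 mul1r; apply => a; rewrite big_ord1 mul1r hE.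
Qed.

Lemma eq_kval mu phi psi : (forall a, holds S phi a <-> holds S psi a) ->
  kval mu phi = kval mu psi.
Proof.
move=> H; apply/eqP; rewrite eq_le.
have K : forall phi psi, (forall a, holds S phi a <-> holds S psi a) ->
    kval mu phi <= kval mu psi.
  move=> {H}phi {}psi H.
  have := @kval_le mu bool (fun b => if b then 1 else -1)
    (fun b => if b then phi else psi) 0.
  rewrite big_bool/= mulN1r mul1r subr_le0; apply => a.
  by rewrite big_bool/= mulN1r mul1r (eq_truth (H a)) subrr.
by rewrite !K// => a; rewrite H.
Qed.

End Values.

Section Restriction.
Context (I : Type) (mu : keisler R S I) (N : set U).

Let res : borel_ctype S [set: U] I -> borel_ctype S N I :=
  tres (@subsetT U N) (I := I).

HB.instance Definition _ := isMeasurableFun.Build _ _ _ _ res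
  (@measurable_tres _ _ S _ _ (@subsetT U N) I).

(** Convertible to [krestr], but bundled as the probability that the integration lemmas ask for. *)
Definition kdist : probability (borel_ctype S N I) R :=
  distribution (kmeas mu) res.

Lemma kdist_clop (phi : pform L U I) : over N phi ->
  fine (kdist (clop phi)) = kval mu phi.
Proof.
move=> Nphi; rewrite /kval; congr (fine (kmeas mu _)).
by apply/seteqP; split=> p /=; [move=> [_]|split].
Qed.

Lemma le_fine_prob d (T : measurableType d) (P : probability T R)
    (A B : set T) :
  measurable A -> measurable B -> A `<=` B -> fine (P A) <= fine (P B).
Proof.
by move=> mA mB AB; rewrite fine_le ?fin_num_measure// le_measure// inE.
Qed.

Lemma le_fine_probU d (T : measurableType d) (P : probability T R)
    (A B C : set T) :
  measurable A -> measurable B -> measurable C -> A `<=` B `|` C ->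
  fine (P A) <= fine (P B) + fine (P C).
Proof.
move=> mA mB mC ABC; rewrite -fineD ?fin_num_measure// fine_le//.
- exact: fin_num_measure.
- by rewrite fin_numD !fin_num_measure.
rewrite (@le_trans _ _ (P (B `|` C)))//.
  by rewrite le_measure// inE//; exact: measurableU.
exact: measureU2.
Qed.

(** Regularity is given for the global measure. Compact sets inside the preimages of [B] and of its
    complement have compact, disjoint images in the types over [N], and a clopen set separates these
    images. *)
Lemma clop_approx (B : set (borel_ctype S N I)) (e : R) :
  measurable B -> 0 < e ->
  exists2 phi : pform L U I, over N phi &
    fine (kdist ((B `\` clop phi) `|` (clop phi `\` B))) <= e.
Proof.
move=> mB e0; have e20 : 0 < e / 2 by rewrite divr_gt0.
have mB' : measurable (res @^-1` B).
  by rewrite -[X in measurable X]setTI; apply: (@measurable_tres _ _ S _ _ (@subsetT U N) I).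
have [C [V [cC oV CB BV VC]]] := kmeas_regular mu mB' e20.
have [C' [V' [cC' oV' CB' BV' VC']]] := kmeas_regular mu (measurableC mB') e20.
have cres : continuous (res : ctype S setT I -> ctype S N I).
  exact: tres_continuous.
have cK : compact (res @` C : set (ctype S N I)).
  apply: continuous_compact => //; exact: continuous_subspaceT.
have cK' : compact (res @` C' : set (ctype S N I)).
  apply: continuous_compact => //; exact: continuous_subspaceT.
have oK' : open (~` (res @` C') : set (ctype S N I)).
  by apply: closed_openC; apply: compact_closed => //; exact: ctype_hausdorff.
have [|phi [Nphi Cphi phiC']] := compact_clop cK oK'.
  move=> _ [p Cp <-] [p' C'p' E]; apply: (CB' _ C'p').
  by rewrite /= E; exact: CB.
exists phi => //.
have mVC : measurable (V `\` C : set (borel_ctype S setT I)).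
  by apply: measurableD; [exact: measurable_open|exact: measurable_compact].
have mVC' : measurable (V' `\` C' : set (borel_ctype S setT I)).
  by apply: measurableD; [exact: measurable_open|exact: measurable_compact].
have fineP (X : set (borel_ctype S setT I)) : measurable X ->
    (kmeas mu X < (e / 2)%:E)%E -> fine (kmeas mu X) <= e / 2.
  move=> mX /ltW; rewrite -lee_fin fineK// fin_num_measure//.
rewrite [leRHS](splitr e).
apply: le_trans (lerD (fineP _ mVC VC) (fineP _ mVC' VC')).
apply: (@le_fine_probU _ _ (kmeas mu)) => //.
  rewrite -[X in measurable X]setTI; apply: (@measurable_tres _ _ S _ _ (@subsetT U N) I) => //.
  by apply: measurableU; apply: measurableD => //; exact: measurable_clop.
move=> p [[Bp np]|[pphi nBp]]; [left|right]; split.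
- exact: BV.
- by move=> Cp; apply: np; apply: Cphi; exists p.
- exact: BV'.
- by move=> C'p; apply: (phiC' _ pphi); exists p.
Qed.

End Restriction.

(* The clopen set of [chi] contains a compact set of measure above [e], whose
   image in [S_x(N)] is closed and so meets [X]; saturation realizes the
   resulting type over [N] together with [chi]. *)
Lemma meets_realized (I : finType) (mu : keisler R S I) (N : set U) (K : Type)
    (X : set (ctype S N I)) (e : R) (chi : pform L U I) :
  small K [set: form L nat] -> saturated K S -> small K N ->
  (forall B : set (borel_ctype S N I), measurable B -> e < fine (kdist mu N B) ->
    exists2 q, B q & X q) ->
  e < kval mu chi -> exists2 c, holds S chi c & X (tp S N c).
Proof.
move=> Ksmall satS Nsmall HX echi.
have [u0] := dom_inhabited S.
have mchi : measurable (clop chi : set (borel_ctype S setT I)).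
  exact: measurable_clop.
have e0 : 0 < kval mu chi - e by rewrite subr_gt0.
have [C [V [cC oV Cchi chiV VC]]] := kmeas_regular mu mchi e0.
pose res : ctype S setT I -> ctype S N I := tres (@subsetT U N) (I := I).
have cK : compact (res @` C).
  apply: continuous_compact => //; apply: continuous_subspaceT.
  exact: tres_continuous.
have mC : measurable (C : set (borel_ctype S setT I)) := measurable_compact cC.
have mVC : measurable (V `\` C : set (borel_ctype S setT I)).
  by apply: measurableD => //; exact: measurable_open.
have CC : e < fine (kmeas mu C).
  have : kval mu chi <= fine (kmeas mu C) + fine (kmeas mu (V `\` C)).
    apply: (@le_fine_probU _ _ (kmeas mu)) => // p chip.
    by have [Cp|nCp] := pselect (C p); [left|right; split=> //; exact: chiV].
  have : fine (kmeas mu (V `\` C)) < kval mu chi - e.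
    by rewrite -lte_fin fineK// fin_num_measure.
  by move: (fine _) (fine _) (kval _ _) => x y z; lra.
have mK : measurable (res @` C : set (borel_ctype S N I)) := measurable_compact cK.
have [|_ [p Cp <-] Xp] := HX _ mK.
  apply: lt_le_trans CC _; apply: (@le_fine_prob _ _ (kmeas mu)) => //.
    by rewrite -[X in measurable X]setTI; apply: (@measurable_tres _ _ S _ _ (@subsetT U N) I).
  by move=> q Cq; exists q.
pose A := N `|` [set u | fv chi (inr u)].
have Asmall : small K A.
  exact: (small_setU_finite u0 Ksmall Nsmall (finite_params chi)).
have [c cP] := ctype_realized (tres (@subsetT U A) p) satS Asmall.
exists c.
  by apply: cP; split; [move=> u; right|exact: Cchi].
suff -> : tp S N c = res p by [].
symmetry; apply: realizes_eq => phi [Nphi pphi]; apply: cP; split => //.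
by move=> u /Nphi; left.
Qed.

End KeislerMeasures.

(** * Morley products *)

Section MorleyValues.
Context (R : realType) (L : language) (U : Type) (S : structure L U).

(** [fim] and [invariant] speak of L-formulas with parameters indexed by ['I_k]. The parameters of
    [phi] are made variables too, and [c d] lists [d] followed by these fixed parameters. *)
Lemma pinst_inst (I : Type) (J : finType) (u0 : U)
    (phi : pform L U (I + J)%type) :
  exists k (psi : form L (I + 'I_k)%type) (c : (J -> U) -> 'I_k -> U),
    (forall d, pinst phi d = inst psi (c d)) /\
    forall A : set U, A u0 -> over A phi ->
      forall d d', same_type S A d d' -> same_type S A (c d) (c d').
Proof.
have [k [phi' [c0 [phiE cP]]]] := param_fin u0 phi.
pose c (d : J -> U) (i : 'I_(#|J| + k)) :=
  match fintype.split i with inl j => d (enum_val j) | inr i => c0 i end.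
pose h (v : (I + J) + 'I_k) : (I + 'I_(#|J| + k))%type := match v with
  | inl (inl i) => inl i
  | inl (inr j) => inr (lshift k (enum_rank j))
  | inr i => inr (rshift #|J| i)
  end.
exists (#|J| + k)%N, (fren h phi'), c; split=> [d|A Au0 Aphi d d' dd' chi Achi].
  rewrite phiE /pinst /inst !fren_comp; congr fren; apply: funext => v.
  case: v => [[i|j]|i] //=; congr inr; rewrite /c.
    by rewrite (unsplitK (inl _)) enum_rankK.
  by rewrite (unsplitK (inr _)).
have Ac0 i : A (c0 i) by have [/Aphi|->] := cP i.
pose chi' : pform L U J := fren (fun v => match v with
  | inl i => match fintype.split i with
             | inl j => inl (enum_val j) | inr i => inr (c0 i) end
  | inr u => inr u end) chi.
have Achi' : over A chi'.
  move=> u; rewrite /chi' fv_fren => -[[i|v] fvv] /=.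
    by case: fintype.split => // j [<-].
  by move=> [<-]; exact: Achi.
have holdsE e : holds S chi (c e) <-> holds S chi' e.
  rewrite /holds /chi' sat_fren (_ : _ \o _ = fun v : 'I_(#|J| + k) + U =>
    match v with inl i => c e i | inr u => u end) //.
  by apply: funext => -[i|//] /=; rewrite /c; case: fintype.split.
by rewrite !holdsE; exact: dd'.
Qed.

Section Good.
Context (I J : finType).
Implicit Types (mu : keisler R S I) (phi : pform L U (I + J)%type).

Definition good mu phi (e : R) n (a : 'I_n -> I -> U) : Prop :=
  forall d : J -> U, `|kval mu (pinst phi d) -
    \sum_i n%:R^-1 * truth R S (pinst phi d) (a i)| <= e.

Lemma truth_pswap phi (a : I -> U) (d : J -> U) :
  truth R S (pinst (pswap phi) a) d = truth R S (pinst phi d) a.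
Proof.
by apply: eq_truth; rewrite !holds_pinst holds_pswap.
Qed.

Lemma AvE n (a : 'I_n -> I -> U) (psi : pform L U I) :
  Av R S a psi = \sum_i n%:R^-1 * truth R S psi (a i).
Proof.
rewrite /Av mulrC -mulr_sumr; congr (_ * _).
by rewrite -sum1_card natr_sum big_mkcond; apply: eq_bigr => i _ /=;
  rewrite /truth inE; case: ifP.
Qed.

Lemma fim_good (K : Type) (M : set U) mu phi (e : R) :
  elementary_sub S M -> fim K M mu -> 0 < e ->
  exists n (theta : pform L U ('I_n.+1 * I)%type)
         (nu : keisler R S ('I_n.+1 * I)%type),
    [/\ over M theta, morley_power K M mu nu, 1 - e <= kval nu theta &
        forall a : 'I_n.+1 -> I -> U,
          holds S theta (fun v => a v.1 v.2) -> good mu phi e a].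
Proof.
move=> [SM _] [_ H] e0; have [u0] := dom_inhabited SM.
have [k [psi [c [phiE _]]]] := pinst_inst (\val u0) phi.
have [n [theta [nu [Mtheta pnu nutheta thetaP]]]] := H k psi e e0.
exists n, theta, nu; split=> // a /(fun h b => thetaP b a h) aP d.
by rewrite phiE -AvE; exact: aP.
Qed.

Lemma kval_same_type (M A : set U) mu phi (d d' : J -> U) :
  elementary_sub S M -> invariant M mu -> M `<=` A -> over A phi ->
  same_type S A d d' -> kval mu (pinst phi d) = kval mu (pinst phi d').
Proof.
move=> [SM _] H MA Aphi dd'; have [u0] := dom_inhabited SM.
have [k [psi [c [phiE cP]]]] := pinst_inst (\val u0) phi.
rewrite !phiE; apply: H => chi Mchi; apply: (cP A _ Aphi _ _ dd').
  by apply: MA; exact: set_valP.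
exact: overS MA Mchi.
Qed.

(* By finite satisfiability the symmetric difference of two instances whose
   parameters have the same type is null. *)
Lemma kval_same_type_fs (M A : set U) mu phi (d d' : J -> U) :
  finitely_satisfiable M mu -> M `<=` A -> over A phi ->
  same_type S A d d' -> kval mu (pinst phi d) = kval mu (pinst phi d').
Proof.
move=> fs MA Aphi.
suff H (b b' : J -> U) : same_type S A b b' ->
    kval mu (pinst phi b) <= kval mu (pinst phi b').
  by move=> dd'; apply/eqP; rewrite eq_le !H//; exact: same_type_sym.
move=> bb'.
pose chi : pform L U I := FAnd (pinst phi b) (FNot (pinst phi b')).
have chi0 : kval mu chi = 0.
  apply/eqP; rewrite eq_le kval_ge0 andbT leNgt; apply/negP => /fs[a [Ma]].
  move=> [/holds_pinst ab nab']; apply: nab'; apply/holds_pinst.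
  have holdsE e : holds S (pinst (pswap phi) a) e <-> holds S phi (glue a e).
    by rewrite holds_pinst holds_pswap.
  apply/holdsE/bb'; last exact/holdsE.
  apply: (@overS L U (A `|` range a)).
    by move=> u [//|[i _ <-]]; exact: MA.
  by apply: over_pinst; exact: over_pswap.
rewrite -[leRHS]addr0 -chi0.
have := @kval_le R L U S I mu 'I_3 (fun i => if i == 0 then 1 else -1)
  (fun i => if i == 0 then pinst phi b else if i == 1 then pinst phi b' else chi)
  0.
rewrite !big_ord_recl big_ord0 /= mul1r !mulN1r addr0 -opprD subr_le0; apply.
move=> a; rewrite !big_ord_recl big_ord0 /= mul1r !mulN1r addr0 -opprD subr_le0.
have [hb|hb] := pselect (holds S (pinst phi b) a); last first.
  by rewrite [X in X <= _]truth0// addr_ge0// truth_ge0.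
rewrite [X in X <= _]truth1//.
have [hb'|hb'] := pselect (holds S (pinst phi b') a).
  by rewrite [X in X + _]truth1// lerDl truth_ge0.
by rewrite [X in _ + X]truth1 ?lerDr ?truth_ge0.
Qed.

Lemma fiber_fun (N : set U) (h : (J -> U) -> R) :
  (forall d d', same_type S N d d' -> h d = h d') ->
  (forall d, 0 <= h d <= 1) ->
  exists f : borel_ctype S N J -> R, (forall q, 0 <= f q <= 1) /\
    forall (q : ctype S N J) d, realizes q d -> f q = h d.
Proof.
move=> hE h01.
(* The value 0 is a default for types without a realization; saturation excludes them when [N] is
   small. *)
exists (fun q : ctype S N J => if pselect (exists d, realizes q d) is left e
  then h (projT1 (cid e)) else 0); split=> [q|q d qd].
  by case: pselect => // _; rewrite lexx ler01.
case: pselect => [e|[]]; last by exists d.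
by apply: hE; apply: (realizes_same (p := q)) => //; exact: projT2 (cid e).
Qed.

Context (K : Type).
Hypothesis Ksmall : small K [set: form L nat].
Hypothesis satS : saturated K S.

Section Fibers.
Variables (mu : keisler R S I) (la : keisler R S J).
Variables (phi : pform L U (I + J)%type) (N : set U).
Variable f : borel_ctype S N J -> R.
Hypotheses (Nsmall : small K N) (Nphi : over N phi).
Hypothesis fE : forall (q : ctype S N J) d,
  realizes q d -> f q = kval mu (pinst phi d).

Lemma fiber01 q : 0 <= f q <= 1.
Proof.
have [d qd] := ctype_realized (q : ctype S N J) satS Nsmall.
by rewrite (fE qd) kval_ge0 kval_le1.
Qed.

Lemma fiber_norm q : `|f q| <= 1.
Proof. by have /andP[f0 f1] := fiber01 q; rewrite ger0_norm. Qed.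

Lemma measurable_fiber (M : set U) : elementary_sub S M -> fim K M mu ->
  elementary_sub S N -> M `<=` N -> measurable_fun [set: borel_ctype S N J] f.
Proof.
move=> elM mufim elN MN.
(* The error 1/(k+2) tends to 0 and is below 1, so that [theta] has positive measure and is
   consistent. *)
have /choice[h hP] : forall k : nat, exists h : borel_ctype S N J -> R,
    measurable_fun [set: borel_ctype S N J] h /\
    forall q, `|f q - h q| <= k.+2%:R^-1.
  move=> k; have k0 : (0 : R) < k.+2%:R^-1 by rewrite invr_gt0.
  have [n [theta [nu [Mtheta _ nutheta thetaP]]]] := fim_good phi elM mufim k0.
  (* The tuple is taken inside [N]: the averaged formulas are then over [N] and define clopen sets
     of types over [N]. *)
  have [|b [Nb thetab]] := elementary_realize elN (overS MN Mtheta).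
    apply: (@kval_gt0_holds R L U S _ nu); apply: lt_le_trans nutheta.
    by rewrite subr_gt0 invf_lt1// ltr1n.
  pose a i x := b (i, x).
  have {thetaP} aP : good mu phi k.+2%:R^-1 a.
    apply: thetaP; rewrite (_ : (fun v => _) = b)//.
    by apply: funext => -[].
  pose chi i := pinst (pswap phi) (a i).
  have Nchi i : over N (chi i).
    apply: (@overS L U (N `|` range (a i))); last first.
      by apply: over_pinst; exact: over_pswap.
    by move=> u [//|[j _ <-]]; exact: Nb.
  have mclop i : measurable (clop (chi i) : set (borel_ctype S N J)).
    exact: measurable_clop.
  have [mh _ _] := Rintegral_simple (kdist la N) (index_enum 'I_n.+1)
    (fun=> n.+1%:R^-1) mclop.
  eexists; split; first exact: mh.
  move=> q; have [d qd] := ctype_realized (q : ctype S N J) satS Nsmall.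
  rewrite (fE qd); apply: le_trans (aP d); rewrite le_eqVlt; apply/orP; left.
  apply/eqP; congr `|_ - _|; apply: eq_bigr => i _; congr (_ * _).
  rewrite -truth_pswap indicE /truth; congr (_%:R); congr nat_of_bool.
  by apply/idP/asboolP; rewrite inE; move/(realizesP qd (Nchi i)).
apply: (@measurable_fun_cvg _ _ _ _ h) => [k|q _]; first by have [] := hP k.
apply/cvgrPdist_le => e e0; near=> k.
have [_ /(_ q)/le_trans] := hP k; apply.
near: k; exists (Num.truncn e^-1) => // k /= ke.
rewrite invf_ple ?posrE// ltW//; apply: lt_le_trans (truncnS_gt _) _.
by rewrite ler_nat ltnW.
Unshelve. all: by end_near. Qed.

(** The tuple [a] may lie outside [N], so the integral is pulled back to the global types, where the
    formulas at [a] are clopen. A global type is then realized over [N] and the entries of [a] at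
    once. *)
Lemma fiber_near (e : R) n (a : 'I_n -> I -> U) :
  measurable_fun [set: borel_ctype S N J] f ->
  good mu phi e a ->
  `|\int[kdist la N]_q f q -
    \sum_i n%:R^-1 * kval la (pinst (pswap phi) (a i))| <= e.
Proof.
move=> mf aP.
pose res : borel_ctype S setT J -> borel_ctype S N J :=
  tres (@subsetT U N) (I := J).
have mres : measurable_fun setT res := @measurable_tres _ _ S _ _ (@subsetT U N) J.
have mfres : measurable_fun setT (f \o res) by exact: measurableT_comp.
have -> : \int[kdist la N]_q f q = \int[kmeas la]_p f (res p).
  rewrite /Rintegral; congr fine.
  rewrite -[LHS]/(\int[pushforward (kmeas la) res]_q (f q)%:E)%E.
  rewrite integral_pushforward//.
    exact/measurable_EFinP.
  exact: (integrable_bounded _ mfres (fun=> fiber_norm _)).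
pose chi i := pinst (pswap phi) (a i).
have mclop i : measurable (clop (chi i) : set (borel_ctype S setT J)).
  exact: measurable_clop.
have [mh hc <-] := Rintegral_simple (kmeas la) (index_enum 'I_n)
  (fun=> n%:R^-1) mclop.
apply: (@Rintegral_near _ _ _ _ _ _ (Num.max 1 (\sum_(i < n) `|n%:R^-1|))) => //.
- by move=> p; rewrite le_max fiber_norm.
- by move=> p; rewrite le_max hc orbT.
move=> p; have [u0] := dom_inhabited S.
pose ra := range (fun v : 'I_n * I => a v.1 v.2).
have Asmall : small K (N `|` ra).
  apply: (small_setU_finite u0 Ksmall Nsmall).
  by apply: finite_image; exact: finite_finset.
have [d pd] := ctype_realized (tres (@subsetT U (N `|` ra)) (p : ctype S setT J))
  satS Asmall.
have qd : realizes (res p) d.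
  by move=> psi [Npsi ppsi]; apply: pd; split=> // u /Npsi; left.
rewrite (fE qd); apply: le_trans (aP d); rewrite le_eqVlt; apply/orP; left.
apply/eqP; congr `|_ - _|; apply: eq_bigr => i _; congr (_ * _).
rewrite -truth_pswap indicE /truth; congr (_%:R); congr nat_of_bool.
have Achi : over (N `|` ra) (chi i).
  apply: (@overS L U (N `|` range (a i))); last first.
    by apply: over_pinst; exact: over_pswap.
  by move=> u [|[x _ <-]]; [left|right; exists (i, x)].
have := realizesP pd Achi; rewrite tresE// => chiE.
by apply/idP/asboolP; rewrite inE => /chiE.
Qed.

End Fibers.
End Good.
End MorleyValues.

(** * Morley products and powers of a fim measure, computed by finite averages *)

Section MorleyPower.
Context (R : realType) (L : language) (U : Type) (S : structure L U).
Context (K : Type) (M : set U).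
Hypothesis Ksmall : small K [set: form L nat].
Hypothesis satS : saturated K S.
Hypothesis elM : elementary_sub S M.

(** This is the form in which Markov's inequality is applied; [psi] enters [kval_le] at the index
    [None], with coefficient -1. *)
Lemma kval_le_option (V : Type) (mu : keisler R S V) (B : finType) (c : R)
    (chi : B -> pform L U V) (psi : pform L U V) (k : R) :
  (forall a, \sum_b c * truth R S (chi b) a <= truth R S psi a + k) ->
  \sum_b c * kval mu (chi b) <= kval mu psi + k.
Proof.
move=> H.
have sumE (F : pform L U V -> R) :
    \sum_(o : option B) (if o is Some b then c else -1) *
      F (if o is Some b then chi b else psi) = \sum_b c * F (chi b) - F psi.
  rewrite (bigD1 None)//= mulN1r addrC; congr (_ - _).
  rewrite (reindex_omap Some id)/=; last by case.
  by apply: eq_bigl => b; rewrite eqxx.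
rewrite addrC -lerBlDr -(sumE (kval mu)); apply: kval_le => a.
by rewrite (sumE (fun chi => truth R S chi a)) lerBlDr addrC.
Qed.

Section Values.
Context (I J : finType).
Implicit Types (mu : keisler R S I) (la : keisler R S J).
Implicit Types (phi : pform L U (I + J)%type).

(* [r] is the value of the Morley product at [phi], computed from finite
   averages instead of integrals. *)
Definition average_value mu la phi (r : R) : Prop :=
  forall (e : R) n (a : 'I_n -> I -> U), good mu phi e a ->
    `|r - \sum_i n%:R^-1 * kval la (pinst (pswap phi) (a i))| <= e.

Lemma ex_good mu phi (e : R) : fim K M mu -> 0 < e ->
  exists n (a : 'I_n.+1 -> I -> U), good mu phi e a.
Proof.
(* The cap 1/2 keeps 1 - e' positive, so that [theta] is consistent. *)
move=> mufim e0; pose e' := Num.min e 2^-1.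
have e'0 : 0 < e' by rewrite lt_min e0 invr_gt0/=.
have [n [theta [nu [_ _ nutheta thetaP]]]] := fim_good phi elM mufim e'0.
have [|b thetab] := @kval_gt0_holds R L U S _ nu theta.
  apply: lt_le_trans nutheta; rewrite subr_gt0 gt_min; apply/orP; right.
  by rewrite invf_lt1// ltr1n.
exists n, (fun i x => b (i, x)) => d.
have /(thetaP (fun i x => b (i, x))) : holds S theta (fun v => b (v.1, v.2)).
  by rewrite (_ : (fun v => _) = b)//; apply: funext => -[].
by move=> /(_ d)/le_trans; apply; rewrite ge_min lexx.
Qed.

Lemma average_value_uniq mu la phi (r r' : R) : fim K M mu ->
  average_value mu la phi r -> average_value mu la phi r' -> r = r'.
Proof.
move=> mufim rP r'P; apply/eqP; rewrite -subr_eq0 -normr_le0.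
apply/ler_addgt0Pr => e e0; rewrite add0r.
have e20 : 0 < e / 2 by rewrite divr_gt0.
have [n [a aP]] := ex_good phi mufim e20.
have := r'P _ _ _ aP; have := rP _ _ _ aP.
set s := \sum_i _ => rs r's; rewrite (_ : r - r' = (r - s) - (r' - s)); last by ring.
by rewrite (le_trans (ler_normB _ _))// [leRHS]splitr lerD.
Qed.

Lemma morley_value_average mu la phi (r : R) : fim K M mu ->
  morley_value K M mu la phi r -> average_value mu la phi r.
Proof.
move=> mufim [[N NN] H] e n a aP.
have [f [fE [g [mg fg ig]]]] := H N NN.
have [Nsmall elN MN Nphi] := NN.
have mf := measurable_fiber satS la Nsmall Nphi fE elM mufim elN MN.
suff -> : r = \int[kdist la N]_q f q.
  exact: (fiber_near Ksmall satS la Nsmall Nphi fE mf aP).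
apply: EFin_inj.
rewrite -(Rintegral_EFin _ mf (fiber_norm satS Nsmall fE)) -ig.
apply: (@ae_eq_integral _ _ _ (kdist la N)) => //.
- exact/measurable_EFinP.
- exact/measurable_EFinP.
- have {}fg : \forall q \ae kdist la N, f q = g q := fg.
  by apply: filterS fg => q fgq _; rewrite fgq.
Qed.

(** The average values make no reference to [N] and determine [r], so the integrals over all
    admissible [N] coincide. *)
Lemma ex_morley_product mu la : fim K M mu -> small K M ->
  exists nu : pform L U (I + J)%type -> R, morley_product K M mu la nu /\
    forall phi, average_value mu la phi (nu phi).
Proof.
move=> mufim Msmall.
suff H phi : exists r, morley_value K M mu la phi r.
  have [nu nuP] := choice H; exists nu; split=> // phi.
  exact: morley_value_average.
have [N0 N0P] := ex_model_around S phi Ksmall Msmall.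
have HN N : model_around S K M phi N -> exists r,
    morley_value_at mu la phi N r /\ average_value mu la phi r.
  move=> [Nsmall elN MN Nphi].
  have [|d|f [f01 fE]] := @fiber_fun R L U S J N (fun d => kval mu (pinst phi d)).
  - by move=> d d'; exact: (kval_same_type elM mufim.1 MN Nphi).
  - by rewrite kval_ge0 kval_le1.
  have mf := measurable_fiber satS la Nsmall Nphi fE elM mufim elN MN.
  exists (\int[kdist la N]_q f q); split; last first.
    by move=> e n a; exact: (fiber_near Ksmall satS la Nsmall Nphi fE mf).
  exists f; split=> //; exists f; split=> //.
    by have : \forall q \ae kdist la N, f q = f q by exact: nearW.
  exact: (Rintegral_EFin (kdist la N) mf (fiber_norm satS Nsmall fE)).
have [r [_ rP]] := HN _ N0P.
exists r; split; first by exists N0.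
move=> N /HN[r' [+ r'P]].
by rewrite (average_value_uniq mufim rP r'P).
Qed.

End Values.

Context (I : finType) (mu : keisler R S I).
Hypothesis mufim : fim K M mu.

Lemma morley_power_marginal n (nu : keisler R S ('I_n.+1 * I)%type)
    (chi : pform L U I) (i : 'I_n.+1) :
  morley_power K M mu nu ->
  kval nu (pren (fun x => (i, x)) chi) = kval mu chi.
Proof.
elim: n nu i => [|n IH] nu i /=.
  by move=> ->; rewrite pren_comp -[in RHS](pren_id chi).
move=> [nu' pnu' prod].
have lastE (phi : pform L U (I + 'I_n.+1 * I)%type) :
    average_value mu nu' phi (kval nu (pren (@last_var I n) phi)).
  exact: morley_value_average.
case: (unliftP ord_max i) => [j|] ->.
  have -> : pren (fun x => (lift ord_max j, x)) chi =
      pren (@last_var I n) (pren (fun x => inr (j, x)) chi).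
    rewrite pren_comp; congr pren; apply: funext => x /=.
    by congr (_, x); apply: val_inj; rewrite /= /bump leqNgt ltn_ord.
  set phi := pren _ chi.
  apply/eqP; rewrite -subr_eq0 -normr_le0; apply/ler_addgt0Pr => e e0.
  rewrite add0r; have [m [a aP]] := ex_good phi mufim e0.
  (* For an old variable [phi] does not involve the new one, so by induction every summand has the
     same value and the average equals it. *)
  have := lastE phi _ _ _ aP; rewrite (_ : \sum_i _ = kval mu chi)//.
  rewrite -(IH _ j pnu') -mulr_sumr.
  under eq_bigr => k _.
    rewrite (@eq_kval _ _ _ _ _ _ _ (pren (fun x => (j, x)) chi)); last first.
      by move=> d; rewrite holds_pinst holds_pswap !holds_pren.
    over.
  by rewrite sumr_const card_ord -[X in _ * X]mulr_natl mulrA mulVf ?mul1r// pnatr_eq0.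
have -> : pren (fun x => (ord_max, x)) chi =
    pren (@last_var I n) (pren inl chi) by rewrite pren_comp.
set phi := pren _ chi.
apply/eqP; rewrite -subr_eq0 -normr_le0; apply/ler_addgt0Pr => e e0.
rewrite add0r; have e20 : 0 < e / 2 by rewrite divr_gt0.
have [m [a aP]] := ex_good phi mufim e20.
have [u0] := dom_inhabited S.
have := aP (fun=> u0); have := lastE phi _ _ _ aP.
(* For the new variable the instances at [a k] are constant in the old ones, so their measure is a
   truth value; both sides are then compared with the same average. *)
rewrite (eq_bigr (fun k => m.+1%:R^-1 * truth R S chi (a k))); last first.
  move=> k _; congr (_ * _); apply: kval_const => d.
  rewrite holds_pinst holds_pswap holds_pren.
  by split=> /asboolP.
rewrite [in X in _ -> X -> _](eq_bigr (fun k => m.+1%:R^-1 * truth R S chi (a k))); last first.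
  by move=> k _; congr (_ * _); apply: eq_truth; rewrite holds_pinst holds_pren.
rewrite (@eq_kval _ _ _ _ _ mu _ chi); last first.
  by move=> c; rewrite holds_pinst holds_pren.
set s := \sum_i _ => rs r's.
rewrite (_ : _ - _ = (kval nu (pren (@last_var I n) phi) - s) - (kval mu chi - s)); last by ring.
by rewrite (le_trans (ler_normB _ _))// [leRHS]splitr lerD.
Qed.

Definition first_var n (v : 'I_n.+2 * I) : (I + 'I_n.+1 * I)%type :=
  if unlift ord_max v.1 is Some j then inr (j, v.2) else inl v.2.

Lemma first_varK n : cancel (@first_var n) (@last_var I n).
Proof.
move=> [i x]; rewrite /first_var /=; case: unliftP => [j|] -> //=.
by congr (_, x); apply: val_inj; rewrite /= /bump leqNgt ltn_ord.
Qed.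

Lemma last_varK n : cancel (@last_var I n) (@first_var n).
Proof.
move=> [x|[j x]]; rewrite /first_var /=; first by rewrite unlift_none.
rewrite (_ : widen_ord _ j = lift ord_max j) ?liftK//.
by apply: val_inj; rewrite /= /bump leqNgt ltn_ord.
Qed.

(* If [X] has outer measure at least [1 - e] then [X^(n+1)] has outer measure at
   least [1 - (n+1) e] for the Morley power. *)
Lemma morley_power_meets (N : set U) (X : set (ctype S N I)) (e : R) n
    (nu : keisler R S ('I_n.+1 * I)%type) theta :
  small K N -> 0 <= e ->
  (forall B : set (borel_ctype S N I), measurable B -> e < fine (kdist mu N B) ->
    exists2 q, B q & X q) ->
  morley_power K M mu nu -> n.+1%:R * e < kval nu theta ->
  exists2 a, holds S theta a & forall i, X (tp S N (fun x => a (i, x))).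
Proof.
move=> Nsmall e0 HX; elim: n nu theta => [|n IH] nu theta /=.
  move=> ->; rewrite mul1r => /(meets_realized Ksmall satS Nsmall HX)[c thc Xc].
  by exists (c \o snd); [exact/holds_pren|].
move=> [nu' pnu' prod] lt_theta.
pose phi := pren (@first_var n) theta.
have thetaE : theta = pren (@last_var I n) phi.
  rewrite /phi pren_comp -[LHS]pren_id; congr pren.
  by apply: funext => v /=; rewrite first_varK.
have phiP : average_value mu nu' phi (kval nu theta).
  by rewrite {1}thetaE; exact: morley_value_average.
(* The slack is three times [del]: one part for replacing fibres by averages, one for the threshold
   of [psi], one for the strict inequality. *)
pose del := (kval nu theta - n.+2%:R * e) / 3.
have del0 : 0 < del by rewrite divr_gt0// subr_gt0.
have [m [a aP]] := ex_good phi mufim del0.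
pose chi i := pinst (pswap phi) (a i).
(* The condition that the fibre at [d] has mu-measure above [e] need not be definable; [psi]
   replaces it by a condition on the average over [a], which implies it. *)
have [psi psiP] := bool_comb S chi
  (fun v : {ffun 'I_m.+1 -> bool} => e + del < \sum_i m.+1%:R^-1 * (v i)%:R).
have {}psiP d : holds S psi d <-> e + del < \sum_i m.+1%:R^-1 * truth R S (chi i) d.
  by rewrite psiP; under eq_bigr do rewrite ffunE.
have lt_psi : n.+1%:R * e < kval nu' psi.
  have : \sum_i m.+1%:R^-1 * kval nu' (chi i) <= kval nu' psi + (e + del).
    apply: kval_le_option => d.
    have [hd|] := boolP (e + del < \sum_i m.+1%:R^-1 * truth R S (chi i) d).
      rewrite [X in _ <= X + _]truth1; last exact/psiP.
      rewrite (@le_trans _ _ (\sum_(i < m.+1) m.+1%:R^-1))//.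
        by apply: ler_sum => i _; rewrite ler_piMr ?truth_le1.
      rewrite sumr_const card_ord -[X in X <= _]mulr_natl mulfV ?pnatr_eq0//.
      by rewrite lerDl addr_ge0// ltW.
    by rewrite -leNgt => le_d; rewrite (le_trans le_d)// lerDr truth_ge0.
  have := phiP _ _ _ aP; rewrite ler_distlC => /andP[+ _].
  have -> : \sum_i m.+1%:R^-1 * kval nu' (pinst (pswap phi) (a i)) =
    \sum_i m.+1%:R^-1 * kval nu' (chi i) by [].
  have E2 : n.+2%:R * e = n.+1%:R * e + e by rewrite -addn1 natrD mulrDl mul1r.
  move: lt_theta; rewrite /del E2.
  move: (\sum_i _) (kval nu theta) (kval nu' psi) (n.+1%:R * e) => s x y z.
  by lra.
have [d psid Xd] := IH nu' psi pnu' lt_psi.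
have lt_phi : e < kval mu (pinst phi d).
  have := aP d; rewrite ler_distlC => /andP[_].
  move/psiP: psid; under eq_bigr do rewrite truth_pswap.
  by move: (\sum_i _) => s; lra.
have [c phic Xc] := meets_realized Ksmall satS Nsmall HX lt_phi.
exists (glue c d \o @first_var n) => [|i].
  rewrite thetaE; apply/holds_pren; rewrite -compA.
  rewrite (_ : @first_var n \o @last_var I n = id); first exact/holds_pinst.
  by apply: funext => v /=; rewrite last_varK.
by rewrite /first_var /=; case: unliftP => [j|] _ /=; [exact: Xd|exact: Xc].
Qed.

End MorleyPower.

(** * The product with the factors exchanged *)

Section Squeeze.
Context d (T : measurableType d) (R : realType) (P : probability T R).

Lemma le_fine_prob_bigU (F : nat -> set T) n : (forall k, measurable (F k)) ->
  fine (P (\bigcup_(k in `I_n) F k)) <= \sum_(k < n) fine (P (F k)).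
Proof.
move=> mF; elim: n => [|n IH].
  by rewrite II0 bigcup_set0 measure0 big_ord0.
rewrite big_ord_recr /=; apply: le_trans (lerD IH (lexx _)).
apply: le_fine_probU => //.
- by apply: bigcup_measurable.
- by apply: bigcup_measurable.
- move=> x [k /= kn Fkx]; move: kn; rewrite ltnS leq_eqVlt => /predU1P[<-|kn].
    by right.
  by left; exists k.
Qed.

(* The measurable envelopes of [f] and [1 - f] leave no room between the lower
   and the upper integral of [f]. *)
Lemma envelope_squeeze (f g g' : T -> R) (r : R) :
  measurable_fun [set: T] g -> (forall x, 0 <= g x <= 1) ->
  measurable_fun [set: T] g' -> (forall x, 0 <= g' x <= 1) ->
  (forall x, f x <= g x) -> (forall x, 1 - f x <= g' x) ->
  \int[P]_x g x <= r -> \int[P]_x g' x <= 1 - r ->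
  (\forall x \ae P, f x = g x) /\ \int[P]_x g x = r.
Proof.
move=> mg g01 mg' g'01 fg fg' gr g'r.
have norm01 (k : T -> R) : (forall x, 0 <= k x <= 1) -> forall x, `|k x| <= 1.
  by move=> k01 x; have /andP[k0 k1] := k01 x; rewrite ger0_norm.
have ig := integrable_bounded P mg (norm01 _ g01).
have ig' := integrable_bounded P mg' (norm01 _ g'01).
pose h x := g x + g' x - 1.
have h0 x : 0 <= h x by rewrite /h; move: (fg x) (fg' x); lra.
have mgg' : measurable_fun [set: T] (fun x => g x + g' x : R).
  exact: measurable_funD.
have mh : measurable_fun [set: T] h by exact: measurable_funB.
have hI : \int[P]_x h x = \int[P]_x g x + \int[P]_x g' x - 1.
  rewrite /h RintegralB//; last 2 first.
  - by have := integrableD measurableT ig ig'.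
  - by apply: (@integrable_bounded _ _ _ P (cst 1) 1) => // x; rewrite normr1.
  by rewrite RintegralD// Rintegral_cst1.
have hI0 : \int[P]_x h x = 0.
  apply/eqP; rewrite eq_le Rintegral_ge0// andbT hI; move: gr g'r.
  by move: (\int[P]_x g x) (\int[P]_x g' x) => u v; lra.
split; last first.
  move: hI0 gr g'r; rewrite hI.
  by move: (\int[P]_x g x) (\int[P]_x g' x) => u v; lra.
have hb x : `|h x| <= 2.
  rewrite ger0_norm// /h; have /andP[_] := g01 x; have /andP[_] := g'01 x.
  by lra.
have mEh : measurable_fun [set: T] (EFin \o h) by exact/measurable_EFinP.
have aeh : ae_eq P [set: T] (EFin \o h) (cst 0%E).
  apply/(ae_eq_integral_abs P measurableT mEh).
  rewrite (_ : (\int[P]_x _)%E = (\int[P]_x (h x)%:E)%E); last first.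
    by apply: eq_integral => x _ /=; rewrite ger0_norm.
  by rewrite (Rintegral_EFin _ mh hb) hI0.
apply: filterS aeh => x /(_ Logic.I) [hx0].
by apply/eqP; rewrite eq_le fg/=; move: hx0 (fg' x); rewrite /h; lra.
Qed.

End Squeeze.

(** The sum counts the levels (k+1)/(m+1) below [x]; it equals the integer part of x(m+1), divided
    by m+1. *)
Lemma step_approx (R : realType) (x : R) m : 0 <= x <= 1 ->
  \sum_(k < m.+1) m.+1%:R^-1 * (k.+1%:R / m.+1%:R <= x)%R%:R <= x <=
  \sum_(k < m.+1) m.+1%:R^-1 * (k.+1%:R / m.+1%:R <= x)%R%:R + m.+1%:R^-1.
Proof.
move=> /andP[x0 x1]; set s := \sum_(k < m.+1) _; have m0 : (0 : R) < m.+1%:R by rewrite ltr0n.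
have y0 : 0 <= x * m.+1%:R by rewrite mulr_ge0// ltW.
pose j := Num.truncn (x * m.+1%:R).
have jm : (j <= m.+1)%N.
  by rewrite -(ler_nat R) (le_trans _ (ler_piMl (ltW m0) x1))// truncn_le.
have count n : \sum_(k < n) ((k < j)%N : nat) = minn n j.
  elim: n => [|n IH]; first by rewrite big_ord0 min0n.
  by rewrite big_ord_recr /= IH /minn; case: (ltnP n j); case: (ltnP n.+1 j); lia.
have -> : s = m.+1%:R^-1 * j%:R.
  rewrite -[in RHS](minn_idPr jm) -count natr_sum mulr_sumr.
  apply: eq_bigr => k _; congr (_ * _%:R); congr nat_of_bool.
  by rewrite ler_pdivrMr// -truncn_gt_nat.
have /andP[jl jr] := truncn_itv y0.
rewrite mulrC ler_pdivrMr// jl /= -[X in _ + X]mul1r -mulrDl ler_pdivlMr// ltW//.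
by rewrite natr1.
Qed.

(** * Upper integrals bounded by averages over tuples *)

Section UpperIntegral.
Context (R : realType) (L : language) (U : Type) (S : structure L U).
Context (K : Type) (M : set U) (I : finType) (mu : keisler R S I).
Hypothesis Ksmall : small K [set: form L nat].
Hypothesis satS : saturated K S.
Hypothesis elM : elementary_sub S M.
Hypothesis mufim : fim K M mu.
Variables (N : set U) (f : borel_ctype S N I -> R) (r : R).
Hypothesis Nsmall : small K N.

(** All that [envelope_le] uses about [f] and [r]. It passes to [1 - f] and [1 - r], which gives the
    lower integral. *)
Definition averages_to : Prop := forall e : R, 0 < e ->
  exists n (theta : pform L U ('I_n.+1 * I)%type)
         (nu : keisler R S ('I_n.+1 * I)%type),
    [/\ morley_power K M mu nu, 1 - e <= kval nu theta &
        forall a, holds S theta a ->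
          `|\sum_i n.+1%:R^-1 * f (tp S N (fun x => a (i, x))) - r| <= e].

(* Approximate the envelope [g] by a clopen step function [s].  Almost all of
   the mass of the Morley power lies on tuples whose average of [s] is near the
   integral of [g]; among them some tuple has [s <= f] up to a small error at
   each coordinate, and its average of [f] is near [r]. *)
Lemma envelope_le (g : borel_ctype S N I -> R) :
  averages_to ->
  measurable_fun [set: borel_ctype S N I] g -> (forall q, 0 <= g q <= 1) ->
  (forall (B : set (borel_ctype S N I)) (e : R), measurable B -> 0 < e ->
      (forall q, B q -> f q <= g q - e) -> fine (kdist mu N B) = 0) ->
  \int[kdist mu N]_q g q <= r.
Proof.
move=> avg mg g01 gtight; apply/ler_addgt0Pr => e0 e0_gt0.
(* Eight errors add up at the end: four from [t], one from [eta], two from the step width and one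
   from [theta]. The bound 1/4 gives [t >= -1]. *)
pose e := Num.min (e0 / 8) 4^-1.
have e_gt0 : 0 < e by rewrite lt_min divr_gt0//= invr_gt0.
have e_le : e * 8 <= e0 by rewrite -ler_pdivlMr// ge_min lexx.
have e_4 : e <= 4^-1 by rewrite ge_min lexx orbT.
have [n [theta [nu [pnu nutheta thetaP]]]] := avg e e_gt0.
have n0 : (0 : R) < n.+1%:R by rewrite ltr0n.
(* [morley_power_meets] loses [eta] at each of the n+1 coordinates, in all e/2, less than the
   measure [e] found for [psi]. *)
pose eta := e / 2 / n.+1%:R.
have eta0 : 0 < eta by rewrite !divr_gt0.
have eta_e : eta <= e.
  rewrite /eta ler_pdivrMr// ler_pdivrMr// -[leLHS]mulr1 -mulrA ler_pM2l//.
  by rewrite -natrM ler1n muln_gt0.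
have [m me] : exists m, (m.+1%:R^-1 : R) <= e.
  by exists (Num.truncn e^-1); rewrite invf_ple ?posrE// ltW// truncnS_gt.
have m0 : (0 : R) < m.+1%:R by rewrite ltr0n.
have mi0 : 0 <= m.+1%:R^-1 :> R by rewrite invr_ge0 ltW.
pose B (k : nat) : set (borel_ctype S N I) := [set q | k.+1%:R / m.+1%:R <= g q].
have mB k : measurable (B k).
  have -> : B k = setT `&`
      (fun q => (cst (k.+1%:R / m.+1%:R) q <= g q)%R) @^-1` [set true].
    by rewrite setTI; apply/seteqP; split=> q /=.
  exact: (measurable_fun_ler (measurable_cst _) mg).
have /choice[chi chiP] : forall k, exists phi : pform L U I, over N phi /\
    fine (kdist mu N ((B k `\` clop phi) `|` (clop phi `\` B k))) <= eta / m.+1%:R.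
  move=> k; have [|phi Nphi phiP] := @clop_approx R L U S I mu N (B k) (eta / m.+1%:R) (mB k).
    by rewrite divr_gt0.
  by exists phi.
pose D k : set (borel_ctype S N I) := (B k `\` clop (chi k)) `|` (clop (chi k) `\` B k).
have mclop k : measurable (clop (chi k) : set (borel_ctype S N I)).
  exact: measurable_clop.
have mD k : measurable (D k) by apply: measurableU; apply: measurableD.
pose W := \bigcup_(k in `I_m.+1) D k.
have mW : measurable W by apply: bigcup_measurable.
have WE : fine (kdist mu N W) <= eta.
  apply: le_trans (le_fine_prob_bigU (kdist mu N) m.+1 mD) _.
  apply: (@le_trans _ _ (\sum_(k < m.+1) eta / m.+1%:R)).
    by apply: ler_sum => k _; have [] := chiP k.
  by rewrite sumr_const card_ord -[X in X <= _]mulr_natl mulrCA mulfV ?mulr1// gt_eqF.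
pose s q := \sum_(k < m.+1) m.+1%:R^-1 * \1_(clop (chi k) : set (borel_ctype S N I)) q : R.
have [ms sc sI] := Rintegral_simple (kdist mu N) (index_enum 'I_m.+1)
  (fun=> m.+1%:R^-1) (fun k : 'I_m.+1 => mclop k).
have s01 q : 0 <= s q <= 1.
  apply/andP; split.
    by apply: sumr_ge0 => k _; rewrite mulr_ge0.
  apply: (@le_trans _ _ (\sum_(k < m.+1) m.+1%:R^-1)).
    by apply: ler_sum => k _; rewrite ler_piMr//.
  by rewrite sumr_const card_ord -[X in X <= _]mulr_natl mulfV// gt_eqF.
have sg q : ~ W q -> s q <= g q <= s q + m.+1%:R^-1.
  move=> nW; have := step_approx m (g01 q).
  rewrite (_ : \sum_k _ = s q)//; apply: eq_bigr => k _; congr (_ * _).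
  rewrite indicE; congr (_%:R); congr nat_of_bool.
  apply/idP/idP; rewrite inE => h; apply: contrapT => nh; apply: nW;
    exists (k : nat); try exact: ltn_ord.
    by left.
  by right.
pose X : set (ctype S N I) := [set q | s q - m.+1%:R^-1 <= f q].
(* Outside [W] a type not in [X] has [f] below [g] by the step width, and a Borel set of such types
   is null by tightness. So [A], having measure above that of [W], meets [X]. *)
have XP (A : set (borel_ctype S N I)) : measurable A -> eta < fine (kdist mu N A) ->
    exists2 q, A q & X q.
  move=> mA; rewrite ltNge => /negP H; apply: contrapT => nX; apply: H.
  apply: le_trans WE.
  have mAW : measurable (A `\` W) by exact: measurableD.
  have -> : fine (kdist mu N W) = fine (kdist mu N (A `\` W)) + fine (kdist mu N W).
    rewrite (gtight (A `\` W) m.+1%:R^-1) ?add0r ?invr_gt0// => q [Aq /sg/andP[sq _]].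
    rewrite (le_trans _ (lerB sq (lexx _)))// ltW// ltNge; apply/negP => Xq.
    by apply: nX; exists q.
  apply: le_fine_probU => // q Aq.
  by have [Wq|nWq] := pselect (W q); [right|left].
pose E := \sum_(k < m.+1) m.+1%:R^-1 * kval mu (chi k).
have gE : \int[kdist mu N]_q g q <= E + eta + m.+1%:R^-1.
  have -> : E = \int[kdist mu N]_q s q.
    rewrite /s sI; apply: eq_bigr => k _; rewrite kdist_clop//.
    by have [] := chiP k.
  have sgq q : ~ W q -> g q <= s q + m.+1%:R^-1 by move=> /sg/andP[].
  apply: le_trans (le_Rintegral_off (kdist mu N) mg g01 ms s01 mW sgq mi0) _.
  by rewrite lerD2r lerD2l.
pose chi2 (p : 'I_n.+1 * 'I_m.+1) : pform L U ('I_n.+1 * I)%type :=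
  pren (fun x => (p.1, x)) (chi p.2).
pose c : R := n.+1%:R^-1 * m.+1%:R^-1.
pose F (a : 'I_n.+1 * I -> U) := \sum_p c * truth R S (chi2 p) a.
pose t := E - 4 * e.
have c0 : 0 < c by rewrite mulr_gt0 ?invr_gt0.
have [psi0 psi0P] := bool_comb S chi2
  (fun v : {ffun 'I_n.+1 * 'I_m.+1 -> bool} => t <= \sum_p c * (v p)%:R).
have {}psi0P a : holds S psi0 a <-> t <= F a.
  by rewrite psi0P; under eq_bigr do rewrite ffunE.
pose psi : pform L U ('I_n.+1 * I)%type := FAnd theta psi0.
pose rho : pform L U ('I_n.+1 * I)%type := FNot (FAnd theta (FNot psi0)).
have F1 a : F a <= 1.
  apply: (@le_trans _ _ (\sum_(p : 'I_n.+1 * 'I_m.+1) c)).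
    by apply: ler_sum => p _; rewrite ler_piMr ?truth_le1// ltW.
  rewrite sumr_const card_prod !card_ord -[X in X <= _]mulr_natl natrM /c.
  by rewrite mulrACA !mulfV ?mulr1// gt_eqF.
(* The mean of [F] under the Morley power is [E], because every coordinate has marginal [mu]. *)
have EF : E = \sum_p c * kval nu (chi2 p).
  rewrite -(pair_bigA _ (fun i k => c * kval nu (chi2 (i, k))))/=.
  rewrite (eq_bigr (fun=> \sum_(k < m.+1) c * kval mu (chi k))); last first.
    move=> i _; apply: eq_bigr => k _; congr (_ * _).
    exact: (morley_power_marginal Ksmall satS elM mufim).
  rewrite sumr_const card_ord -[RHS]mulr_natl mulr_sumr; apply: eq_bigr => k _.
  by rewrite /c !mulrA mulfV ?mul1r// gt_eqF.
have E0 : 0 <= E.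
  by apply: sumr_ge0 => k _; rewrite mulr_ge0 ?kval_ge0// invr_ge0 ltW.
(* Markov's inequality for F/2: it is below t/2 where [rho] fails and at most 1 + t/2 elsewhere.
   Halving makes [t >= -1] suffice, which covers means [E] smaller than 4e. *)
have rho_ge : 2 * e <= kval nu rho.
  have : \sum_p (c / 2) * kval nu (chi2 p) <= kval nu rho + t / 2.
    apply: kval_le_option => a.
    have -> : \sum_p c / 2 * truth R S (chi2 p) a = F a / 2.
      by rewrite /F mulr_suml; apply: eq_bigr => p _; rewrite mulrAC.
    have [ra|nra] := pselect (holds S rho a).
      rewrite [X in _ <= X + _]truth1//; have := F1 a; rewrite /t.
      by move: E0 e_4; lra.
    rewrite [X in _ <= X + _]truth0// add0r ler_pM2r ?invr_gt0//.
    have /psi0P/negP : ~ holds S psi0 a.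
      by move=> pa; apply: nra => -[_]; exact.
    by rewrite -ltNge => /ltW.
  have -> : \sum_p c / 2 * kval nu (chi2 p) = E / 2.
    by rewrite EF mulr_suml; apply: eq_bigr => p _; rewrite mulrAC.
  by rewrite /t; move: (kval nu rho) => x; lra.
(* [theta] and [rho] together imply [psi], and their measures add up to at least 1 + e. *)
have psi_ge : e <= kval nu psi.
  have : \sum_(b : bool) 1 * kval nu (if b then rho else theta) <= kval nu psi + 1.
    apply: kval_le_option => a; rewrite big_bool /= !mul1r.
    have [ta|nta] := pselect (holds S theta a); last first.
      by rewrite [X in _ + X <= _]truth0// addr0 ler_wpDl ?truth_le1 ?truth_ge0.
    have [pa|npa] := pselect (holds S psi0 a).
      by rewrite [X in _ <= X + _]truth1//= lerD ?truth_le1.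
    by rewrite [X in X + _ <= _]truth0 ?add0r ?ler_wpDl ?truth_le1 ?truth_ge0//; apply.
  rewrite big_bool /= !mul1r.
  by move: rho_ge nutheta; move: (kval nu rho) (kval nu theta) (kval nu psi) => x y z; lra.
have lt_psi : n.+1%:R * eta < kval nu psi.
  apply: lt_le_trans psi_ge; rewrite /eta mulrC divfK ?gt_eqF//.
  by rewrite ltr_pdivrMr// ltr_pMr// ltr1n.
have [a [thetaa /psi0P Fa] Xa] := morley_power_meets Ksmall satS elM mufim
  Nsmall (ltW eta0) XP pnu lt_psi.
have := thetaP a thetaa; rewrite ler_distl => /andP[_].
have : F a - m.+1%:R^-1 <= \sum_i n.+1%:R^-1 * f (tp S N (fun x => a (i, x))).
  have -> : F a = \sum_i n.+1%:R^-1 * s (tp S N (fun x => a (i, x))).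
    rewrite /F -(pair_bigA _ (fun i k => c * truth R S (chi2 (i, k)) a))/=.
    apply: eq_bigr => i _; rewrite /s mulr_sumr; apply: eq_bigr => k _.
    rewrite /c -mulrA; congr (_ * (_ * _)); rewrite indicE /truth.
    congr (_%:R); congr nat_of_bool; apply/asboolP/idP.
      by rewrite holds_pren inE /= => h; split=> //; have [] := chiP k.
    by rewrite inE => -[_]; rewrite holds_pren.
  have -> : m.+1%:R^-1 = \sum_(i < n.+1) n.+1%:R^-1 * m.+1%:R^-1 :> R.
    by rewrite sumr_const card_ord -[RHS]mulr_natl mulrA mulfV ?mul1r// gt_eqF.
  rewrite -sumrB; apply: ler_sum => i _; rewrite -mulrBr ler_pM2l ?invr_gt0//.
  exact: Xa.
move: Fa gE me eta_e e_le; rewrite /t.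
move: (\int[_]_q _) (\sum_i _) (F a) (m.+1%:R^-1) => x1 x2 x3 x4.
by lra.
Qed.

End UpperIntegral.

Theorem theorem5p5 (R : realType) (L : language) (T : set (sentence L))
  (K U : Type) (S : structure L U) (M : set U) (I J : finType)
  (mu : keisler R S I) (la : keisler R S J)
  (T_complete : complete_theory T)
  (S_model : models S T)
  (S_monster : monster K S)
  (M_model : elementary_sub S M)
  (M_small : small K M)
  (mu_fim : fim K M mu)
  (la_fs : finitely_satisfiable M la) :
  exists nu : pform L U (I + J)%type -> R,
    morley_product K M mu la nu /\
    morley_product K M la mu (fun phi => nu (pswap phi)).
Proof.
have [Ksmall satS _] := S_monster.
have [nu [nuP nu_avg]] := ex_morley_product Ksmall satS M_model la mu_fim M_small.
exists nu; split=> // phi; split; first exact: ex_model_around.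
move=> N [Nsmall elN MN Nphi].
have [|c|f [f01 fE]] := @fiber_fun R L U S I N (fun c => kval la (pinst phi c)).
- by move=> c c' cc'; exact: kval_same_type_fs la_fs MN Nphi cc'.
- by rewrite kval_ge0 kval_le1.
exists f; split=> //.
(* At realized types [f] takes the values of [la] on the instances at [a], and their average is the
   one that computes [nu] at the swapped formula. *)
have avg : averages_to K M mu f (nu (pswap phi)).
  move=> e e0.
  have [n [theta [nu' [_ pnu' nutheta thetaP]]]] :=
    fim_good (pswap phi) M_model mu_fim e0.
  exists n, theta, nu'; split=> // a thetaa.
  have aP : good mu (pswap phi) e (fun i x => a (i, x)).
    apply: thetaP; rewrite (_ : (fun v => _) = a)//.
    by apply: funext => -[].
  rewrite distrC; have := nu_avg (pswap phi) _ _ _ aP; rewrite pswapK.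
  rewrite (eq_bigr (fun i => n.+1%:R^-1 * f (tp S N (fun x => a (i, x)))))//.
  by move=> i _; rewrite (fE _ _ (@realizes_tp L U S N I _)).
pose f' q := 1 - f q.
have f'01 q : 0 <= f' q <= 1.
  by have := f01 q; rewrite /f' subr_ge0 lerBlDr lerDl andbC.
have avg' : averages_to K M mu f' (1 - nu (pswap phi)).
  move=> e /avg[n [theta [nu' [pnu' nutheta thetaP]]]].
  exists n, theta, nu'; split=> // a /thetaP.
  rewrite distrC; congr (`|_| <= _).
  rewrite [X in _ = X - _](_ : _ = 1 - \sum_i n.+1%:R^-1 *
    f (tp S N (fun x => a (i, x)))); first by ring.
  under eq_bigr do rewrite mulrBr mulr1.
  by rewrite sumrB sumr_const card_ord -[X in X - _ = _]mulr_natl mulfV ?pnatr_eq0.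
have [g [mg g01 fg gtight]] := upper_envelope (kdist mu N) f01.
have [g' [mg' g'01 fg' g'tight]] := upper_envelope (kdist mu N) f'01.
have gle := envelope_le Ksmall satS M_model mu_fim Nsmall avg mg g01 gtight.
have g'le := envelope_le Ksmall satS M_model mu_fim Nsmall avg' mg' g'01 g'tight.
have [aefg gI] := envelope_squeeze mg g01 mg' g'01 fg fg' gle g'le.
exists g; split => //.
rewrite -gI; apply: (Rintegral_EFin (kdist mu N) mg (c := 1)) => q.
by have /andP[g0 g1] := g01 q; rewrite ger0_norm.
Qed.
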